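(* Let $(\mathcal X,\rho)$ be a separable metric space with base point $\mathrm e\in\mathcal X$, let $\Xi$ be a second-countable locally compact Hausdorff space, let $\kappa:\mathcal X\times\Xi\to\mathbb R$ be an $(L,\rho)$-Lipschitz I-RKBS kernel, and let $(\mathcal U,\|\cdot\|_{\mathcal U})$ be the corresponding I-RKBS. Let $\Theta$ be the set of all finite tuples $\theta=((a_1,\xi_1),\dots,(a_K,\xi_K))$ with $K\in\mathbb N$, $a_j\in\mathbb R$, $\xi_j\in\Xi$; let $f_\theta=\sum_{j=1}^Ka_j\kappa(\cdot,\xi_j)$ and $C(\theta)=\sum_{j=1}^K|a_j|$. Let $R$ be the extended representation cost constructed from $(\Theta,f_\theta,C)$ in $\mathcal B=\mathrm{Lip}(\mathcal X)$. Then for any $f\in\mathrm{Lip}(\mathcal X)$, $$R(f)=\begin{cases}\|f\|_{\mathcal U},&f\in\mathcal U,\\+\infty,&f\in\mathrm{Lip}(\mathcal X)\setminus\mathcal U.\end{cases}$$ In this case, the native space is $\mathcal F=\{f\in\mathrm{Lip}(\mathcal X):R(f)<+\infty\}=\mathcal U$.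
   Context: **I-RKBS.** $C_0(\Xi)$ is the space of continuous real functions on $\Xi$ vanishing at infinity with the sup norm, and $\mathcal M(\Xi)=C_0(\Xi)'$ the finite signed Radon measures with total variation norm $\|\cdot\|_{\mathcal M}$. An I-RKBS kernel is a function $\kappa:\mathcal X\times\Xi\to\mathbb R$ with $\kappa(x,\cdot)\in C_0(\Xi)$ for all $x\in\mathcal X$ and $\mathrm{span}\{\kappa(x,\cdot):x\in\mathcal X\}$ dense in $C_0(\Xi)$. Then $T_\kappa:\nu\mapsto\int_\Xi\kappa(\cdot,\xi)\,d\nu(\xi)$ is injective on $\mathcal M(\Xi)$; the corresponding I-RKBS is $\mathcal U=T_\kappa(\mathcal M(\Xi))$ with $\|T_\kappa\nu\|_{\mathcal U}=\|\nu\|_{\mathcal M}$. $\kappa$ is $(L,\rho)$-Lipschitz if $\|\kappa(x,\cdot)-\kappa(z,\cdot)\|_{L^\infty}\le L\rho(x,z)$ for all $x,z\in\mathcal X$ (this implies $\mathcal U\subset\mathrm{Lip}(\mathcal X)$). **Lipschitz space and weak\* topology.** $\mathrm{Lip}(\mathcal X)$ is the space of real Lipschitz functions on $\mathcal X$, with norm $\max\{|f|_{\mathrm{Lip}},|f(\mathrm e)|\}$, $|f|_{\mathrm{Lip}}=\sup_{x\neq y}|f(x)-f(y)|/\rho(x,y)$. The Arens–Eells space $\mathrm{AE}(\mathcal X)$ is the completion of the span of $\{\delta_x-\delta_y:x,y\in\mathcal X\}$ under $\|m\|=\inf\{\sum_i|a_i|\rho(x_i,y_i): m=\sum_ia_i(\delta_{x_i}-\delta_{y_i})\}$;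 it is the predual of the Lipschitz functions vanishing at $\mathrm e$, via $\langle\sum_ia_i(\delta_{x_i}-\delta_{y_i}),g\rangle=\sum_ia_i(g(x_i)-g(y_i))$. $\mathrm{Lip}(\mathcal X)$ is isometrically the dual of $\mathrm{AE}(\mathcal X)\oplus_1\mathbb R$, and $w^*$ is the corresponding weak\* topology: the coarsest topology making $f\mapsto\langle m,f-f(\mathrm e)\rangle$ ($m\in\mathrm{AE}(\mathcal X)$) and $f\mapsto f(\mathrm e)$ continuous. **Extended representation cost.** $R_\Theta(f)=\inf\{C(\theta):\theta\in\Theta,\ f_\theta=f\}$ for $f\in\mathrm{Lip}(\mathcal X)$ ($\inf\varnothing=+\infty$). $R$ is the largest $w^*$-lower semicontinuous function on $\mathrm{Lip}(\mathcal X)$ bounded above by $R_\Theta$ (lower semicontinuous: all sublevel sets $\{\cdot\le\alpha\}$, $\alpha\in\mathbb R$, closed). *)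

(* Defs.v *)
From HB Require Import structures.
From mathcomp Require Import all_boot all_order all_algebra.
From mathcomp Require Import all_classical all_reals all_analysis.

Set Implicit Arguments.
Unset Strict Implicit.
Unset Printing Implicit Defensive.

Import Order.TTheory GRing.Theory Num.Theory.
Import numFieldNormedType.Exports.
Local Open Scope quotient_scope.
Local Open Scope classical_set_scope.
Local Open Scope ring_scope.

Definition separable (T : topologicalType) :=
  exists2 D : set T, countable D & dense D.

Section Lipschitz.
Context {R : realType} {X : metricType R}.

Definition klip (k : R) (f : X -> R) :=
  forall x y, `|f x - f y| <= k * mdist x y.

Definition lipschitz_fun : set (X -> R) := [set f | exists k, klip k f].

End Lipschitz.

Definition Lip (R : realType) (X : metricType R) : Type :=
  set_type (@lipschitz_fun R X).
HB.instance Definition _ (R : realType) (X : metricType R) :=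
  Choice.on (Lip X).

Definition Lip_fun (R : realType) (X : metricType R) (f : Lip X) : X -> R :=
  val f.
Coercion Lip_fun : Lip >-> Funclass.

Lemma LipP (R : realType) (X : metricType R) (f : Lip X) : lipschitz_fun f.
Proof. exact: (set_mem (valP f)). Qed.

Section ArensEells.
Context {R : realType} {X : metricType R}.
Implicit Types (m : X -> R) (g : X -> R) (s : seq (R * X * X)).

(* The list of the triples (a_i, x_i, y_i) represents
   \sum_i a_i (delta_(x_i) - delta_(y_i)), where delta_x is the indicator
   function of {x}. *)
Definition mol s : X -> R := fun z =>
  \sum_(p <- s) p.1.1 * ((z == p.1.2)%:R - (z == p.2)%:R).

Definition mol_cost s : R := \sum_(p <- s) `|p.1.1| * mdist p.1.2 p.2.

Definition molecule : set (X -> R) := range mol.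

Definition ae_norm m : R := inf [set mol_cost s | s in [set s | mol s = m]].

(* A molecule has finite support, so that the sum below is finite: it is equal
   to \sum_i a_i (g x_i - g y_i), see mol_pairingE. *)
Definition mol_pairing m g : R := \sum_(z \in [set: X]) m z * g z.

Lemma mol_cat s t : mol (s ++ t) = mol s \+ mol t.
Proof. by apply/funext => z; rewrite /mol big_cat. Qed.

Definition mol_opp s := [seq (- p.1.1, p.1.2, p.2) | p <- s].

Lemma mol_oppE s : mol (mol_opp s) = \- mol s.
Proof.
apply/funext => z; rewrite /mol /mol_opp big_map /= -sumrN.
by apply: eq_bigr => p _; rewrite mulNr.
Qed.

Lemma mol_cost_opp s : mol_cost (mol_opp s) = mol_cost s.
Proof.
by rewrite /mol_cost /mol_opp big_map; apply: eq_bigr => p _; rewrite normrN.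
Qed.

Lemma mol_cost_ge0 s : 0 <= mol_cost s.
Proof. by apply: sumr_ge0 => p _; rewrite mulr_ge0 ?mdist_ge0. Qed.

Lemma mol_cost_cat s t : mol_cost (s ++ t) = mol_cost s + mol_cost t.
Proof. by rewrite /mol_cost big_cat. Qed.

Lemma moleculeB m n : molecule m -> molecule n -> molecule (m \- n).
Proof.
move=> [s _ <-] [t _ <-]; exists (s ++ mol_opp t) => //.
by rewrite mol_cat mol_oppE.
Qed.

Lemma ae_norm_le s : ae_norm (mol s) <= mol_cost s.
Proof.
apply: ge_inf; last by exists s.
by exists 0 => _ [t _ <-]; exact: mol_cost_ge0.
Qed.

Lemma ae_norm_ge0 m : molecule m -> 0 <= ae_norm m.
Proof.
move=> [s _ sm]; apply: lb_le_inf; first by exists (mol_cost s), s.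
by move=> _ [t _ <-]; exact: mol_cost_ge0.
Qed.

Lemma ae_norm0 : ae_norm (fun=> 0) = 0.
Proof.
have m0 : mol [::] = (fun=> 0) by apply/funext => z; rewrite /mol big_nil.
apply/eqP; rewrite eq_le ae_norm_ge0 ?andbT; last by exists [::].
by rewrite -m0 (le_trans (ae_norm_le _))// /mol_cost big_nil.
Qed.

Lemma ae_norm_approx m (eps : R) : molecule m -> 0 < eps ->
  exists2 s, mol s = m & mol_cost s < ae_norm m + eps.
Proof.
move=> [s _ sm] e0.
have hi : has_inf [set mol_cost s | s in [set s | mol s = m]].
  split; first by exists (mol_cost s), s.
  by exists 0 => _ [t _ <-]; exact: mol_cost_ge0.
by have [_ [t /= tm <-] lt] := inf_adherent e0 hi; exists t.
Qed.

Lemma ae_normD m n : molecule m -> molecule n ->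
  ae_norm (m \+ n) <= ae_norm m + ae_norm n.
Proof.
move=> mm mn; apply/ler_addgt0Pl => eps e0.
have e20 : 0 < eps / 2 by rewrite divr_gt0.
have [s <- sm] := ae_norm_approx mm e20.
have [t <- tn] := ae_norm_approx mn e20.
rewrite -mol_cat (le_trans (ae_norm_le _))// mol_cost_cat.
rewrite (le_trans (lerD (ltW sm) (ltW tn)))// addrACA -splitr.
by rewrite addrC.
Qed.

Lemma ae_norm_le_opp m : molecule m -> ae_norm (\- m) <= ae_norm m.
Proof.
move=> mm; apply/ler_addgt0Pl => eps e0.
have [s <- sm] := ae_norm_approx mm e0.
by rewrite -mol_oppE (le_trans (ae_norm_le _))// mol_cost_opp ltW// addrC.
Qed.

Lemma ae_distC m n : molecule m -> molecule n ->
  ae_norm (m \- n) = ae_norm (n \- m).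
Proof.
wlog suff h : m n / molecule m -> molecule n -> ae_norm (m \- n) <= ae_norm (n \- m).
  by move=> mm mn; apply/eqP; rewrite eq_le !h.
move=> mm mn; rewrite (_ : m \- n = \- (n \- m)).
  exact/ae_norm_le_opp/moleculeB.
by apply/funext => z /=; rewrite opprB.
Qed.

Lemma ae_dist_triangle n m p : molecule m -> molecule n -> molecule p ->
  ae_norm (m \- p) <= ae_norm (m \- n) + ae_norm (n \- p).
Proof.
move=> mm mn mp; rewrite (_ : m \- p = (m \- n) \+ (n \- p)).
  by apply: ae_normD; exact: moleculeB.
by apply/funext => z /=; rewrite addrA subrK.
Qed.

Lemma mol_pairingE s g :
  mol_pairing (mol s) g = \sum_(p <- s) p.1.1 * (g p.1.2 - g p.2).
Proof.
pose A : seq X := undup ([seq p.1.2 | p <- s] ++ [seq p.2 | p <- s]).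
have uA : uniq A by exact: undup_uniq.
have pA p : p \in s -> (p.1.2 \in A) && (p.2 \in A).
  move=> ps; rewrite !mem_undup !mem_cat; apply/andP; split; apply/orP.
    by left; apply/mapP; exists p.
  by right; apply/mapP; exists p.
have dg x : x \in A -> \sum_(z <- A) (z == x)%:R * g z = g x.
  move=> xA; rewrite (bigD1_seq x)//= eqxx mul1r big1 ?addr0// => z /negbTE ->.
  by rewrite mul0r.
rewrite /mol_pairing (fsbigE A)//; last first.
  move=> z _ zA; rewrite /mol big_seq big1 ?mul0r// => p ps.
  have zE x : x \in A -> (z == x) = false.
    by move=> xA; apply/negbTE; apply: contra zA => /eqP ->.
  by have /andP[p1 p2] := pA _ ps; rewrite !zE ?subrr ?mulr0.
rewrite (eq_bigl xpredT) => [|z]; last by rewrite in_setT.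
under eq_bigr do rewrite /mol mulr_suml.
rewrite exchange_big /= big_seq [RHS]big_seq; apply: eq_bigr => p ps.
under eq_bigr do rewrite -mulrA mulrBl.
by have /andP[p1 p2] := pA _ ps; rewrite -mulr_sumr sumrB !dg.
Qed.

Lemma mol_pairingB m n g : molecule m -> molecule n ->
  mol_pairing (m \- n) g = mol_pairing m g - mol_pairing n g.
Proof.
move=> [s _ <-] [t _ <-]; rewrite (_ : _ \- _ = mol (s ++ mol_opp t)); last first.
  by rewrite mol_cat mol_oppE.
rewrite !mol_pairingE big_cat.
rewrite /mol_opp big_map -sumrN /=; congr (_ + _).
by apply: eq_bigr => p _; rewrite mulNr.
Qed.

Lemma mol_pairing_le k m g : klip k g -> molecule m ->
  `|mol_pairing m g| <= `|k| * ae_norm m.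
Proof.
move=> kg mm; have key s : `|mol_pairing (mol s) g| <= `|k| * mol_cost s.
  rewrite mol_pairingE (le_trans (ler_norm_sum _ _ _))// mulr_sumr.
  apply: ler_sum => p _; rewrite normrM mulrCA ler_wpM2l// (le_trans (kg _ _))//.
  by rewrite ler_wpM2r ?mdist_ge0// ler_norm.
apply/ler_addgt0Pl => eps e0; have k0 : 0 < `|k| + 1 by rewrite ltr_wpDl.
have [s sm sle] := ae_norm_approx mm (divr_gt0 e0 k0).
rewrite -{1}sm (le_trans (key s))// (le_trans (ler_wpM2l _ (ltW sle)))//.
rewrite mulrDr addrC lerD2r mulrCA ler_piMr ?(ltW e0)//.
by rewrite ler_pdivrMr// mul1r lerDl.
Qed.

Definition ae_cauchy : set (nat -> X -> R) := [set u |
  (forall n, molecule (u n)) /\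
  forall eps : R, 0 < eps -> exists N, forall i j, (N <= i)%N -> (N <= j)%N ->
    ae_norm (u i \- u j) < eps].

Definition cauchy_mol : Type := set_type ae_cauchy.
HB.instance Definition _ := Choice.on cauchy_mol.

Definition cauchy_fun (u : cauchy_mol) : nat -> X -> R := val u.
Coercion cauchy_fun : cauchy_mol >-> Funclass.

Lemma cauchy_molP (u : cauchy_mol) : ae_cauchy u.
Proof. exact: (set_mem (valP u)). Qed.

Lemma cauchy_molecule (u : cauchy_mol) n : molecule (u n).
Proof. by have [+ _] := cauchy_molP u; exact. Qed.

Definition ae_equiv (u v : cauchy_mol) : bool :=
  `[< ae_norm (u n \- v n) @[n --> \oo] --> (0 : R) >].

Lemma ae_equiv_refl : reflexive ae_equiv.
Proof.
move=> u; apply/asboolP; rewrite (_ : (fun n => _) = cst 0); first exact: cvg_cst.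
apply/funext => n /=; rewrite -[RHS]ae_norm0; congr ae_norm.
by apply/funext => z /=; rewrite subrr.
Qed.

Lemma ae_equiv_sym : symmetric ae_equiv.
Proof.
move=> u v; apply: asbool_equiv_eq.
rewrite (_ : (fun n => ae_norm (u n \- v n)) = fun n => ae_norm (v n \- u n))//.
by apply/funext => n; apply: ae_distC; exact: cauchy_molecule.
Qed.

Lemma ae_equiv_trans : transitive ae_equiv.
Proof.
move=> v u w /asboolP uv /asboolP vw; apply/asboolP.
apply: (@squeeze_cvgr _ _ _ _ (cst 0)
  (fun n => ae_norm (u n \- v n) + ae_norm (v n \- w n))).
- near=> n; have mu k (t : cauchy_mol) := cauchy_molecule t k.
  by rewrite /= ae_norm_ge0 ?ae_dist_triangle//; exact: moleculeB.
- exact: cvg_cst.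
- by rewrite -[X in _ --> X](addr0 0); exact: cvgD.
Unshelve. all: by end_near. Qed.

Canonical ae_equiv_rel :=
  EquivRel ae_equiv ae_equiv_refl ae_equiv_sym ae_equiv_trans.

End ArensEells.

(* The completion of the space of molecules: Cauchy sequences of molecules
   modulo the sequences that converge to 0. *)
Definition AE (R : realType) (X : metricType R) : Type :=
  {eq_quot (@ae_equiv R X)}.

Section Pairing.
Context {R : realType} {X : metricType R}.

(* When g is Lipschitz, the limit exists and does not depend on the chosen
   representative, see ae_pairingE. *)
Definition ae_pairing (m : AE X) (g : X -> R) : R :=
  limn (fun n => mol_pairing ((repr m : cauchy_mol) n) g).

Lemma mol_pairing_cvg (u : @cauchy_mol R X) (g : Lip X) :
  cvgn (fun n => mol_pairing (u n) g).
Proof.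
have [k kg] := LipP g; have [mu cu] := cauchy_molP u.
apply/cauchy_cvgP/cauchyP => eps e0; have k0 : 0 < `|k| + 1 by rewrite ltr_wpDl.
have [N cN] := cu _ (divr_gt0 e0 k0).
exists (mol_pairing (u N) g).
change (\forall n \near \oo,
  ball (mol_pairing (u N) g) eps (mol_pairing (u n) g)).
near=> n; rewrite /ball/= -mol_pairingB//.
rewrite (le_lt_trans (mol_pairing_le kg (moleculeB (mu N) (mu n))))//.
have uNn : ae_norm (u N \- u n) < eps / (`|k| + 1).
  by apply: cN => //; near: n; exact: nbhs_infty_ge.
apply: (@le_lt_trans _ _ ((`|k| + 1) * ae_norm (u N \- u n))).
  by apply: ler_wpM2r; [exact/ae_norm_ge0/moleculeB|rewrite lerDl].
by rewrite mulrC -ltr_pdivlMr.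
Unshelve. all: by end_near. Qed.

Lemma ae_pairingE (u : @cauchy_mol R X) (g : Lip X) :
  ae_pairing (\pi_(AE X) u) g = limn (fun n => mol_pairing (u n) g).
Proof.
have [k kg] := LipP g.
rewrite /ae_pairing; set v := repr _.
have vu : \pi_({eq_quot (@ae_equiv R X)}) v = \pi u by exact: reprK.
move/eqmodP/asboolP : vu => vu; clearbody v.
have mol_uv n : mol_pairing (v n) g =
    mol_pairing (u n) g + mol_pairing (v n \- u n) g.
  by rewrite mol_pairingB ?subrKC//; exact: cauchy_molecule.
rewrite (_ : (fun n => mol_pairing (v n) g) = fun n =>
  mol_pairing (u n) g + mol_pairing (v n \- u n) g); last exact/funext.
apply/cvg_lim; first exact: Rhausdorff.
rewrite -[X in _ --> X]addr0; apply: cvgD; first exact: mol_pairing_cvg.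
apply/norm_cvg0P; apply: (@squeeze_cvgr _ _ _ _ (cst 0)
  (fun n => `|k| * ae_norm (v n \- u n))).
- near=> n; rewrite /= normr_ge0 (mol_pairing_le kg)//.
  by apply: moleculeB; exact: cauchy_molecule.
- exact: cvg_cst.
- by rewrite -[X in _ --> X](mulr0 `|k|); exact: cvgMl_tmp.
Unshelve. all: by end_near. Qed.

End Pairing.

Section WeakStar.
Context {R : realType} {X : metricType R} (e : X).

Definition wstar_functional (m : option (AE X)) (f : Lip X) : R :=
  if m is Some m then ae_pairing m (fun x => f x - f e) else f e.

(* The coarsest topology on Lip X that makes all the functionals above
   continuous. *)
Definition wstar_Lip : topologicalType :=
  sup_topology (fun m : option (AE X) =>
    Topological.on (initial_topology (wstar_functional m))).

Definition wstar_lsc (G : Lip X -> \bar R) :=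
  forall alpha : R, closed ([set f | (G f <= alpha%:E)%E] : set wstar_Lip).

End WeakStar.

Section RepresentationCost.
Context {R : realType} {X : metricType R} (e : X).
Context {Theta : Type} (ftheta : Theta -> X -> R) (C : Theta -> R).

Definition rep_cost (f : Lip X) : \bar R :=
  ereal_inf [set (C theta)%:E | theta in [set theta | ftheta theta = f]].

Definition lsc_minorant (G : Lip X -> \bar R) :=
  wstar_lsc e G /\ forall f, (G f <= rep_cost f)%E.

Definition ext_rep_cost (f : Lip X) : \bar R :=
  ereal_sup [set G f | G in lsc_minorant].

Lemma ext_rep_cost_minorant : lsc_minorant ext_rep_cost.
Proof.
split=> [alpha|f]; last by apply: ge_ereal_sup => _ [G [_ GC] <-].
rewrite (_ : [set f | _] =
    \bigcap_(G in lsc_minorant) [set f | (G f <= alpha%:E)%E]).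
  by apply: closed_bigI => G [lscG _]; exact: lscG.
apply/seteqP; split=> [f /= le_alpha G mG|f le_alpha] /=.
  by apply: le_trans le_alpha; apply: ereal_sup_ubound; exists G.
by apply: ge_ereal_sup => _ [G mG <-]; exact: le_alpha.
Qed.

Lemma ext_rep_cost_largest G : lsc_minorant G ->
  forall f, (G f <= ext_rep_cost f)%E.
Proof. by move=> mG f; apply: ereal_sup_ubound; exists G. Qed.

Definition native_space : set (X -> R) :=
  [set (f : X -> R) | f in [set f : Lip X | (ext_rep_cost f < +oo)%E]].

End RepresentationCost.

Notation borel T := (g_sigma_algebraType (@open T)).

Section SignedMeasures.
Context {R : realType} {Xi : ptopologicalType}.
Implicit Type nu : {charge set (borel Xi) -> \bar R}.

(* A chosen Hahn decomposition; on the Borel sets, the measures jpos, jneg and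
   abs_charge do not depend on this choice. *)
Definition hahn_proof nu :=
  projT2 (cid (projT2 (cid (Hahn_decomposition nu)))).

Definition jpos nu : {measure set (borel Xi) -> \bar R} :=
  jordan_pos (hahn_proof nu).
Definition jneg nu : {measure set (borel Xi) -> \bar R} :=
  jordan_neg (hahn_proof nu).

Definition abs_charge nu : set Xi -> \bar R :=
  charge_variation (hahn_proof nu).

Definition tv_norm nu : \bar R := abs_charge nu [set: Xi].

Definition radon nu := forall (A : set Xi) (eps : R),
  measurable (A : set (borel Xi)) -> 0 < eps ->
  exists K U : set Xi, [/\ compact K, open U, K `<=` A, A `<=` U &
    (abs_charge nu (U `\` K) < eps%:E)%E].

Definition charge_integral nu (g : Xi -> R) : R :=
  \int[jpos nu]_xi g xi - \int[jneg nu]_xi g xi.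

End SignedMeasures.

Section IRKBS.
Context {R : realType} {X : metricType R} {Xi : ptopologicalType}.
Implicit Types (kappa : X -> Xi -> R) (nu : {charge set (borel Xi) -> \bar R}).

Definition vanishes_at_infinity (g : Xi -> R) :=
  forall eps : R, 0 < eps ->
    exists2 K : set Xi, compact K & forall xi, ~ K xi -> `|g xi| < eps.

Definition C0 : set (Xi -> R) :=
  [set g | continuous g /\ vanishes_at_infinity g].

Definition sup_norm (g : Xi -> R) : \bar R :=
  ereal_sup [set `|g xi|%:E | xi in [set: Xi]].

Definition kernel_span kappa : set (Xi -> R) :=
  [set (fun xi => \sum_(p <- s) p.1 * kappa p.2 xi)
    | s in [set: seq (R * X)]].

Definition irkbs_kernel kappa :=
  (forall x, C0 (kappa x)) /\
  (forall g, C0 g -> forall eps : R, 0 < eps ->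
    exists2 h, kernel_span kappa h & (sup_norm (g \- h)%R < eps%:E)%E).

Definition lipschitz_kernel (L : R) kappa := forall x z,
  (sup_norm (kappa x \- kappa z)%R <= (L * mdist x z)%:E)%E.

Definition T_ kappa nu : X -> R := fun x => charge_integral nu (kappa x).

Definition irkbs kappa : set (X -> R) :=
  [set T_ kappa nu | nu in [set nu | radon nu]].

(* When kappa is an I-RKBS kernel, two Radon charges with the same image under
   T_ kappa agree on the Borel sets, hence have the same tv_norm, so that the
   choice of the preimage of f is immaterial. (They may differ as functions: the
   values of a charge on the non-measurable sets are unconstrained.) *)
Definition irkbs_norm kappa (f : X -> R) (Uf : irkbs kappa f) : \bar R :=
  tv_norm (s2val (cid2 Uf)).

Definition net kappa (theta : seq (R * Xi)) : X -> R :=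
  fun x => \sum_(p <- theta) p.1 * kappa x p.2.

Definition net_cost (theta : seq (R * Xi)) : R := \sum_(p <- theta) `|p.1|.

End IRKBS.

(* Main.v *)
(* Idea. For f : X -> R let N f be the norm of the functional
   sum_i c_i kappa(x_i, .) |-> sum_i c_i f(x_i) on the span of the kernel.
   As a supremum of w*-continuous functions, N is w*-lower semicontinuous, and
   N <= R_Theta, so that N <= R.

   If f = T nu with nu Radon, N f is the norm of nu as a functional on C_0: a
   Hahn decomposition, inner regularity and Urysohn functions give
   N f >= ||nu||. Conversely, replacing nu on the cells of a fine partition by
   point masses yields nets of cost at most ||nu|| that converge to f pointwise
   and are uniformly Lipschitz, hence converge to f in w*; so R f <= ||nu||.

   If N f < +oo, the functional extends to C_0 by density, and is represented by
   a Radon charge nu (Riesz), hence f = T nu. The representation theorem is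
   proved by splitting the functional into two positive ones (Riesz
   decomposition), and attaching to a positive functional P the outer measure
   m A = inf {a : some nondecreasing sequence u_k in C_0^+ with P u_k <= a
   reaches 1 at every point of A}. *)
Require Import Defs.
From HB Require Import structures.
From mathcomp Require Import all_boot all_order all_algebra.
From mathcomp Require Import all_classical all_reals all_analysis.
From mathcomp Require Import measurable_realfun.
From mathcomp Require Import lra ring.

Set Implicit Arguments.
Unset Strict Implicit.
Unset Printing Implicit Defensive.

Import Order.TTheory GRing.Theory Num.Theory.
Import numFieldNormedType.Exports.
Local Open Scope classical_set_scope.
Local Open Scope ring_scope.

(** * Functions vanishing at infinity *)

Section C0_functions.
Context {R : realType} {Xi : ptopologicalType}.
Implicit Types (f g h : Xi -> R).

Lemma C0_le c g f : C0 g -> continuous f ->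
  (forall x, `|f x| <= c * `|g x|) -> C0 f.
Proof.
move=> [cg vg] cf fg; split=> // eps e0.
have c0 : 0 < `|c| + 1 by rewrite ltr_wpDl.
have [K cK gK] := vg _ (divr_gt0 e0 c0).
exists K => // x Kx; apply: (le_lt_trans (fg x)).
apply: (@le_lt_trans _ _ ((`|c| + 1) * `|g x|)).
  by rewrite ler_wpM2r// (le_trans (ler_norm c))// lerDl.
by rewrite mulrC -ltr_pdivlMr// gK.
Qed.

Lemma continuous_fmin f g : continuous f -> continuous g ->
  continuous (fun x => Num.min (f x) (g x)).
Proof.
move=> cf cg x; exact: (@continuous_min _ _ f g x (cf x) (cg x)).
Qed.

Lemma continuous_fmax f g : continuous f -> continuous g ->
  continuous (fun x => Num.max (f x) (g x)).
Proof.
move=> cf cg x; exact: (@continuous_max _ _ f g x (cf x) (cg x)).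
Qed.

Lemma C0D f g : C0 f -> C0 g -> C0 (f \+ g).
Proof.
move=> [cf vf] [cg vg]; split=> [x|eps e0]; first exact: cvgD (cf x) (cg x).
have e20 : 0 < eps / 2 by rewrite divr_gt0.
have [K cK fK] := vf _ e20; have [H cH gH] := vg _ e20.
exists (K `|` H); first exact: compactU.
move=> x KH; rewrite (le_lt_trans (ler_normD _ _))// (splitr eps) ltrD//.
  by apply: fK => Kx; apply: KH; left.
by apply: gH => Hx; apply: KH; right.
Qed.

Lemma C0Z c f : C0 f -> C0 (fun x => c * f x).
Proof.
move=> Cf; apply: (@C0_le `|c| f) => // [x|x]; last by rewrite normrM.
by apply: cvgM; [exact: cvg_cst|exact: Cf.1].
Qed.

Lemma C0B f g : C0 f -> C0 g -> C0 (f \- g).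
Proof.
move=> Cf Cg; rewrite (_ : f \- g = f \+ (fun x => -1 * g x)).
  exact: C0D Cf (C0Z (-1) Cg).
by apply/funext => x /=; rewrite mulN1r.
Qed.

Lemma C0_cst0 : C0 (fun _ : Xi => 0 : R).
Proof.
split=> [x|eps e0]; first exact: cvg_cst.
by exists set0 => [|x _]; [exact: compact0|rewrite normr0].
Qed.

Lemma C0_sum I (s : seq I) (F : I -> Xi -> R) : (forall i, C0 (F i)) ->
  C0 (fun x => \sum_(i <- s) F i x).
Proof.
move=> CF; elim: s => [|i s IH].
  by under eq_fun do rewrite big_nil; exact: C0_cst0.
by under eq_fun do rewrite big_cons; exact: C0D.
Qed.

Lemma C0_bounded f : C0 f -> exists2 B, 0 < B & forall x, `|f x| <= B.
Proof.
move=> [cf vf]; have [K cK fK] := vf 1 ltr01.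
have /compact_bounded[M [_ MK]] : compact (f @` K).
  by apply: continuous_compact => //; exact: continuous_subspaceT.
exists (`|M| + 1); first by rewrite ltr_wpDl.
move=> x; have [Kx|/fK/ltW/le_trans->//] := pselect (K x); last first.
  by rewrite lerDr.
by apply: MK; [rewrite ltr_pwDr// ler_norm|exists x].
Qed.

Lemma compact_C0_superlevel f c : C0 f -> 0 < c -> compact [set x | c <= f x].
Proof.
move=> [cf vf] c0; have [K cK fK] := vf _ c0.
have sub : [set x | c <= f x] `<=` K.
  move=> x /= cx; apply: contrapT => /fK; apply/negP; rewrite -leNgt.
  exact: le_trans cx (ler_norm _).
apply: (subclosed_compact _ cK sub).
by apply: (@preimage_closed _ _ f [set y | c <= y]) => [x _|]; [exact: cf|exact: closed_ge].
Qed.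

Lemma open_gt_continuous f c : continuous f -> open [set x | c < f x].
Proof.
move=> cf; apply: (@open_comp _ _ f [set y | c < y]) => [x _|]; first exact: cf.
exact: open_gt.
Qed.

Lemma compact_nondecreasing_cover (K : set Xi)
    (O : nat -> set Xi) :
  compact K -> (forall n, open (O n)) ->
  (forall m n, (m <= n)%N -> O m `<=` O n) -> K `<=` \bigcup_n O n ->
  exists n, K `<=` O n.
Proof.
rewrite compact_cover => cK oO ndO /(cK nat setT O (fun i _ => oO i))[D _ KD].
(* The sets [O n] increase, so the largest index of the finite subcover serves. *)
exists (\max_(i <- finmap.enum_fset D) i)%N => x /KD[i /= iD]; apply: ndO.
exact: (@leq_bigmax_seq _ _ xpredT id i iD isT).
Qed.

(** One-sided Dini argument. Off a compact set [g] is below [eps] and [u k >= 0] suffices; on the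
    compact set, the open sets where [u k - g > - eps] increase and cover. *)
Lemma dini_C0 g (u : nat -> Xi -> R) (eps : R) : 0 < eps -> C0 g ->
  (forall k, continuous (u k)) -> (forall k x, 0 <= u k x) ->
  (forall x m n, (m <= n)%N -> u m x <= u n x) ->
  (forall x, exists k, g x <= u k x) ->
  exists k, forall x, g x <= u k x + eps.
Proof.
move=> e0 [cg vg] cu u0 ndu gu; have [K cK gK] := vg _ e0.
have [||x _|k kK] := compact_nondecreasing_cover
  (O := fun k => [set x | - eps < u k x - g x]) cK.
- move=> n; apply: (@open_gt_continuous (u n \- g)) => x.
  by apply: cvgB; [exact: cu|exact: cg].
- by move=> m n mn x /=; have := ndu x _ _ mn; lra.
- by have [k ?] := gu x; exists k => //=; lra.
exists k => x; have [/kK/=|/gK] := pselect (K x); first lra.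
by have := ler_norm (g x); have := u0 k x; lra.
Qed.

End C0_functions.

(** * Urysohn functions and monotone approximation of open sets *)

Section second_countable_locally_compact.
Context {R : realType} {Xi : ptopologicalType}.
Hypotheses (scXi : @second_countable Xi) (lcXi : locally_compact [set: Xi])
  (hausXi : hausdorff_space Xi).

(** One minus a Urysohn function that is 0 at [x] and 1 off the intersection of [U] with the
    interior of a compact neighbourhood [V]; the difference vanishes off [V], hence at infinity. *)
Lemma C0_bump (U : set Xi) x : open U -> U x ->
  exists g : Xi -> R, [/\ C0 g, forall y, 0 <= g y, 0 < g x &
    forall y, ~ U y -> g y = 0].
Proof.
move=> oU Ux; have [V] := @lcXi x I; rewrite withinET => Vx [cV clV].
pose B := ~` (U `&` V^°).
have clB : closed B by apply: open_closedC; exact: openI oU (open_interior _).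
have nBx : ~ B x by move=> /(_ (conj Ux Vx)).
have sep := locally_compact_completely_regular (R := R) lcXi hausXi clB nBx.
pose f : Xi -> R := Urysohn [set x] B.
have f01 y : 0 <= f y <= 1.
  have : range f (f y) by exists y.
  by move=> /(@Urysohn_range _ R); rewrite /= in_itv.
have fx : f x = 0 by apply: (Urysohn_sub0 sep); exists x.
have fB y : B y -> f y = 1 by move=> By; apply: (Urysohn_sub1 sep); exists y.
have cf : continuous f by exact: Urysohn_continuous.
exists (fun y => 1 - f y); split=> [|y||y nUy].
- split=> [y|eps e0]; first by apply: cvgB; [exact: cvg_cst|exact: cf].
  exists V => // y nVy; rewrite fB ?subrr ?normr0// => -[_ /interior_subset].
  exact: nVy.
- by have := f01 y; lra.
- by rewrite fx; lra.
- by rewrite fB ?subrr// => -[].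
Qed.

(** Second countability makes the family countable: for each basic open set one function positive on
    it and vanishing off [U] is chosen, if there is any. By [C0_bump] and continuity, every point of
    [U] lies in a basic set that has one. *)
Lemma open_cozero_cover (U : set Xi) : open U ->
  exists h : nat -> Xi -> R, [/\ forall n, C0 (h n), forall n x, 0 <= h n x,
    forall n x, ~ U x -> h n x = 0 & forall x, U x -> exists n, 0 < h n x].
Proof.
move=> oU; have [B /countable_injP[j jinj] [Bop Bnbhs]] := scXi.
pose good g := [/\ C0 g, forall y, 0 <= g y & forall y, ~ U y -> g y = 0 :> R].
pose pos g (b : set Xi) := forall y, b y -> 0 < g y :> R.
(* [j] numbers the basic sets injectively. An index without basic set, or whose basic set admits no
   such function, receives 0. *)
have ex n : exists g, good g /\ forall b, B b -> j b = n ->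
    (exists2 g', good g' & pos g' b) -> pos g b.
  have [[b [Bb jb [g' gg' pg']]]|no] :=
      pselect (exists b, [/\ B b, j b = n & exists2 g', good g' & pos g' b]).
    exists g'; split=> // b' Bb' jb' _.
    by have -> : b' = b by apply: jinj; rewrite ?inE// jb.
  exists (fun=> 0); split; first by split=> //; exact: C0_cst0.
  by move=> b Bb jb gb; exfalso; apply: no; exists b.
have [h hP] := choice ex; exists h; split=> [n|n x|n x|x Ux].
- by have [[]] := hP n.
- by have [[]] := hP n.
- by have [[_ _ + _]] := hP n; exact.
- have [g [Cg g0 gx gU]] := C0_bump oU Ux.
  have : nbhs x [set y | 0 < g y].
    by apply: open_nbhs_nbhs; split=> //; apply: open_gt_continuous Cg.1.
  move=> /Bnbhs[b [Bb bx] bg]; exists (j b).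
  by have [_ /(_ b Bb erefl)] := hP (j b); apply => //; exists g.
Qed.

(** With [s n] the partial sums of a cozero cover of [U], the functions are [min 1 (n * s n)]: the
    factor [n] lifts every positive value to 1 at a finite stage. *)
Lemma open_C0_approx (U : set Xi) : open U ->
  exists w : nat -> Xi -> R, [/\ forall n, C0 (w n),
    forall n x, 0 <= w n x <= 1,
    forall x m n, (m <= n)%N -> w m x <= w n x,
    forall n x, ~ U x -> w n x = 0 & forall x, U x -> exists n, 1 <= w n x].
Proof.
move=> /open_cozero_cover[h [Ch h0 hU Uh]].
pose s n x := \sum_(i < n) h i x.
have s0 n x : 0 <= s n x by exact: sumr_ge0.
have nds x m n : (m <= n)%N -> s m x <= s n x.
  move=> mn; rewrite /s -(subnKC mn) big_split_ord/= lerDl; exact: sumr_ge0.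
have Cs n : C0 (s n) by exact: C0_sum.
exists (fun n x => Num.min 1 (n%:R * s n x)); split.
- move=> n; apply: (@C0_le _ _ n%:R (s n)) => // x.
    apply: continuous_fmin => // y; first exact: cvg_cst.
    by apply: cvgM; [exact: cvg_cst|exact: (Cs n).1].
  rewrite !ger0_norm ?ge_min ?lexx ?orbT// le_min ler01/=.
  by rewrite mulr_ge0.
- by move=> n x; rewrite ge_min lexx le_min ler01 mulr_ge0.
- move=> x m n mn; rewrite le_min ge_min lexx/= ge_min; apply/orP; right.
  by rewrite ler_pM// ?nds// ler_nat.
- by move=> n x nUx; rewrite /s big1 ?mulr0 ?min_r// => i _; exact: hU.
- move=> x /Uh[n hn].
  have sn : 0 < s n.+1 x.
    by rewrite /s big_ord_recr/= ltr_wpDl// sumr_ge0.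
  pose k := (Num.truncn (s n.+1 x)^-1).+1.
  exists (maxn k n.+1); rewrite le_min lexx/=.
  apply: (@le_trans _ _ (k%:R * s n.+1 x)).
    by rewrite -ler_pdivrMr// div1r ltW// truncnS_gt.
  by rewrite ler_pM ?ler_nat ?leq_maxl// nds// leq_maxr.
Qed.

(** By compactness a single member of the approximation of [U] exceeds 1/2 on all of [K]; it is
    doubled and cut off at 1. *)
Lemma compact_open_C0_separation (K U : set Xi) : compact K -> open U ->
  K `<=` U -> exists g : Xi -> R, [/\ C0 g, forall x, 0 <= g x <= 1,
    forall x, K x -> g x = 1 & forall x, ~ U x -> g x = 0].
Proof.
move=> cK /open_C0_approx[w [Cw w01 ndw wU Uw]] KU.
have [||x /KU/Uw[n nx]|n nK] := compact_nondecreasing_cover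
  (O := fun n => [set x | 2^-1 < w n x]) cK.
- by move=> n; apply: open_gt_continuous (Cw n).1.
- by move=> m n mn x /= /lt_le_trans; apply; exact: ndw.
- by exists n => //=; lra.
exists (fun x => Num.min 1 (2 * w n x)); split=> [|x|x /nK/= nx|x /wU ->].
- apply: (@C0_le _ _ 2 (w n)) => // x.
    apply: continuous_fmin => // y; first exact: cvg_cst.
    by apply: cvgM; [exact: cvg_cst|exact: (Cw n).1].
  have /andP[? _] := w01 n x.
  rewrite !ger0_norm ?ge_min ?lexx ?orbT// le_min ler01/=.
  by rewrite mulr_ge0.
- by rewrite ge_min lexx le_min ler01 mulr_ge0//; have /andP[] := w01 n x.
- by rewrite min_l//; lra.
- by rewrite mulr0 min_r.
Qed.

End second_countable_locally_compact.

(** * Borel measures and nonnegative functions of C_0 *)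

Section borel_integration.
Context {R : realType} {Xi : ptopologicalType}.
Implicit Types (f g h : Xi -> R).

Lemma open_borel (U : set Xi) : open U -> measurable (U : set (borel Xi)).
Proof. by move=> oU; exact: sub_sigma_algebra. Qed.

Lemma closed_borel (F : set Xi) : closed F -> measurable (F : set (borel Xi)).
Proof.
move=> cF; rewrite -(setCK F); apply: measurableC.
by apply: open_borel; exact: closed_openC.
Qed.

Lemma continuous_borel f : continuous f ->
  measurable_fun [set: borel Xi] (f : borel Xi -> R).
Proof.
move=> cf; apply: (measurability _ (RGenOInfty.measurableE R)) => //.
move=> _ [_ [x ->] <-]; rewrite setTI; apply: open_borel.
rewrite (_ : f @^-1` _ = [set y | x < f y]); first exact: open_gt_continuous.
by apply/seteqP; split=> y /=; rewrite in_itv/= andbT.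
Qed.

Lemma bounded_integrable (mu : {finite_measure set (borel Xi) -> \bar R})
    (f : borel Xi -> R) c A : measurable A ->
  measurable_fun setT f -> (forall x, `|f x| <= c) ->
  mu.-integrable A (EFin \o f).
Proof.
move=> mA mf fc; apply: measurable_bounded_integrable => //.
- by rewrite ltey_eq fin_num_measure.
- exact: measurable_funTS.
- exists c; split; first exact: num_real.
  by move=> y cy x _; exact: le_trans (fc x) (ltW cy).
Qed.

Lemma C0_integrable (mu : {finite_measure set (borel Xi) -> \bar R}) f A :
  measurable A -> C0 f -> mu.-integrable A (EFin \o (f : borel Xi -> R)).
Proof.
move=> mA Cf; have [c _ fc] := C0_bounded Cf.
by apply: bounded_integrable fc => //; apply: continuous_borel Cf.1.
Qed.

Lemma Rintegral_indicZ (mu : {finite_measure set (borel Xi) -> \bar R}) c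
    (A : set (borel Xi)) :
  measurable A -> \int[mu]_x (c * \1_A x) = c * fine (mu A).
Proof.
move=> mA; rewrite RintegralZl//; last first.
  by apply: (@bounded_integrable _ _ 1) => // x; rewrite indicE normr_nat; case: (_ \in _).
by congr (_ * _); rewrite /Rintegral integral_indic// setIT.
Qed.

(** The functionals of [positive_riesz] are only specified on this cone, because the positive part
    of a signed functional arises as a supremum that makes sense there. *)
Definition C0p g := C0 g /\ forall x, 0 <= g x.

Lemma C0p_le c g f : C0p g -> continuous f -> (forall x, 0 <= f x <= c * g x) ->
  C0p f.
Proof.
move=> [Cg g0] cf fg; split=> [|x]; last by have /andP[] := fg x.
apply: (@C0_le _ _ c g) => // x; have /andP[f0 fx] := fg x.
by rewrite !ger0_norm.
Qed.

Lemma C0pD f g : C0p f -> C0p g -> C0p (f \+ g).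
Proof. by move=> [Cf f0] [Cg g0]; split=> [|x]; [exact: C0D|exact: addr_ge0]. Qed.

Lemma C0pZ c f : 0 <= c -> C0p f -> C0p (fun x => c * f x).
Proof. by move=> c0 [Cf f0]; split=> [|x]; [exact: C0Z|exact: mulr_ge0]. Qed.

Lemma C0pB f g : C0p f -> C0p g -> (forall x, f x <= g x) -> C0p (g \- f).
Proof. by move=> [Cf f0] [Cg g0] fg; split=> [|x]; [exact: C0B|rewrite /= subr_ge0]. Qed.

Lemma C0p_cst0 : C0p (fun _ : Xi => 0 : R).
Proof. by split=> //; exact: C0_cst0. Qed.

Lemma C0p_sum I (s : seq I) (F : I -> Xi -> R) : (forall i, C0p (F i)) ->
  C0p (fun x => \sum_(i <- s) F i x).
Proof.
move=> CF; split=> [|x]; first by apply: C0_sum => i; exact: (CF i).1.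
by apply: sumr_ge0 => i _; exact: (CF i).2.
Qed.

Lemma C0pM f g : C0p f -> C0p g -> C0p (fun x => f x * g x).
Proof.
move=> Cf Cg; have [c c0 fc] := C0_bounded Cf.1.
apply: (@C0p_le c g) => // x.
  by apply: cvgM; [exact: Cf.1.1|exact: Cg.1.1].
rewrite mulr_ge0 ?(Cf.2, Cg.2)//= ler_wpM2r ?Cg.2//.
exact: le_trans (ler_norm _) (fc x).
Qed.

(** The condition of [radon], with a finite measure in place of the variation of a charge. *)
Definition inner_outer_regular (mu : {finite_measure set (borel Xi) -> \bar R}) :=
  forall (A : set Xi) (e : R), measurable (A : set (borel Xi)) -> 0 < e ->
    exists K U : set Xi, [/\ compact K, open U, K `<=` A, A `<=` U &
      (mu (U `\` K) < e%:E)%E].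

End borel_integration.

(** * Riesz representation of positive functionals *)

Section positive_riesz.
Context {R : realType} {Xi : ptopologicalType}.
Hypotheses (scXi : @second_countable Xi) (lcXi : locally_compact [set: Xi])
  (hausXi : hausdorff_space Xi).
Variables (P : (Xi -> R) -> R) (M : R).
Hypothesis P_ge0 : forall g, C0p g -> 0 <= P g.
Hypothesis PD : forall f g, C0p f -> C0p g -> P (f \+ g) = P f + P g.
Hypothesis PZ : forall c g, 0 <= c -> C0p g -> P (fun x => c * g x) = c * P g.
Hypothesis P_bound : forall c g, C0p g -> (forall x, g x <= c) -> P g <= M * c.
Implicit Types (A U X : set Xi) (g h : Xi -> R) (a b e : R).

Let P_le f g : C0p f -> C0p g -> (forall x, f x <= g x) -> P f <= P g.
Proof.
move=> Cf Cg fg; have -> : g = f \+ (g \- f).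
  by apply/funext => x /=; rewrite addrC subrK.
rewrite PD//; last exact: C0pB.
by rewrite lerDl P_ge0//; exact: C0pB.
Qed.

Let P0 : P (fun=> 0) = 0.
Proof.
have := @PZ 0 _ (lexx 0) C0p_cst0; rewrite [X in _ = X]mul0r => E; rewrite -[RHS]E.
by congr P; apply/funext => x; rewrite mul0r.
Qed.

Let P_sum n (F : nat -> Xi -> R) : (forall i, C0p (F i)) ->
  P (fun x => \sum_(i < n) F i x) = \sum_(i < n) P (F i).
Proof.
move=> CF; elim: n => [|n IH].
  by rewrite big_ord0 -[RHS]P0; congr P; apply/funext => x; rewrite big_ord0.
rewrite big_ord_recr/= -IH -PD//; last exact: C0p_sum.
by congr P; apply/funext => x; rewrite big_ord_recr.
Qed.

Let M_ge0 : 0 <= M.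
Proof.
have := P_bound C0p_cst0 (fun=> ler01 : (0 : R) <= 1).
by rewrite P0 mulr1.
Qed.

(** A function of C_0 is at least 1 only on a compact set; a nondecreasing sequence of them can
    cover any set. *)
Definition daniell_cover A a := exists u : nat -> Xi -> R,
  [/\ forall k, C0p (u k), forall x m n, (m <= n)%N -> u m x <= u n x,
    forall k, P (u k) <= a & forall x, A x -> exists k, 1 <= u k x].

Definition daniell_real A : R := inf [set a | daniell_cover A a].

Definition daniell_outer A : \bar R := (daniell_real A)%:E.

Local Notation m := daniell_real.

Let cover_ge0 A a : daniell_cover A a -> 0 <= a.
Proof. by move=> [u [Cu _ ua _]]; exact: le_trans (P_ge0 (Cu 0)) (ua 0). Qed.

(** This makes the infimum in [daniell_real] one of a nonempty set, and bounds the outer measure of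
    every set by [M]. *)
Let cover_M A : daniell_cover A M.
Proof.
have [w [Cw w01 ndw _ wT]] := @open_C0_approx R Xi scXi lcXi hausXi setT openT.
have Cpw k : C0p (w k) by split=> // x; have /andP[] := w01 k x.
exists w; split=> // [k|x _]; last exact: wT.
rewrite -[leRHS]mulr1; apply: P_bound => // x; by have /andP[] := w01 k x.
Qed.

Let has_inf_cover A : has_inf [set a | daniell_cover A a].
Proof.
by split; [exists M; exact: cover_M|exists 0 => a; exact: cover_ge0].
Qed.

Let m_le A a : daniell_cover A a -> m A <= a.
Proof. by move=> Aa; apply: ge_inf => //; exact: (has_inf_cover A).2. Qed.

Let m_ge0 A : 0 <= m A.
Proof. by apply: lb_le_inf => [|a]; [exact: (has_inf_cover A).1|exact: cover_ge0]. Qed.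

Let m_approx A e : 0 < e -> exists2 a, daniell_cover A a & a < m A + e.
Proof. by move=> e0; have [a ? ?] := inf_adherent e0 (has_inf_cover A); exists a. Qed.

Let m_mono A B : A `<=` B -> m A <= m B.
Proof.
move=> AB; apply/ler_addgt0Pr => e e0.
have [a [u [Cu ndu ua uB]] aB] := m_approx B e0.
by apply: le_trans (ltW aB); apply: m_le; exists u; split=> // x /AB/uB.
Qed.

Let m0 : m set0 = 0.
Proof.
apply/eqP; rewrite eq_le m_ge0 andbT; apply: m_le; exists (fun _ _ => 0).
by split=> // k; [exact: C0p_cst0|rewrite P0].
Qed.

Let m_le_P A h : C0p h -> (forall x, A x -> 1 <= h x) -> m A <= P h.
Proof.
move=> Ch hA; apply: m_le; exists (fun=> h); split=> // x /hA.
by exists 0%N.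
Qed.

(** For a cover [u] of [A], Dini gives [h <= u k + d] for some [k]. The excess [r] of [h] over [u k]
    is then at most [d], so [P r <= M * d], and [d] is chosen so that this is at most [e / 2]. *)
Let P_le_m A h : C0p h -> (forall x, h x <= 1) -> (forall x, ~ A x -> h x = 0) ->
  P h <= m A.
Proof.
move=> Ch h1 hA; apply/ler_addgt0Pr => e e0.
have e20 : 0 < e / 2 by rewrite divr_gt0.
have [a [u [Cu ndu ua uA]] aA] := m_approx A e20.
have M10 : 0 < 2 * (M + 1) by have := M_ge0; lra.
pose d := e / (2 * (M + 1)); have d0 : 0 < d by rewrite divr_gt0.
have [|k hk] := dini_C0 d0 Ch.1 (fun k => (Cu k).1.1) (fun k => (Cu k).2) ndu.
  move=> x; have [/uA[k uk]|/hA ->] := pselect (A x).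
    by exists k; exact: le_trans (h1 x) uk.
  by exists 0%N; exact: (Cu 0).2.
pose r x := Num.max 0 (h x - u k x).
have Cr : C0p r.
  apply: (@C0p_le _ _ 1 h) => // x.
    apply: continuous_fmax => y; first exact: cvg_cst.
    by apply: cvgB; [exact: Ch.1.1|exact: (Cu k).1.1].
  rewrite /r le_max lexx/= mul1r ge_max Ch.2/=.
  by have := (Cu k).2 x; lra.
have Pr : P r <= M * d.
  by apply: P_bound => // x; rewrite /r ge_max (ltW d0)/=; have := hk x; lra.
have Md : M * d <= e / 2.
  rewrite /d mulrA ler_pdivrMr//; have := mulr_ge0 (ltW e0) M_ge0; nra.
apply: (@le_trans _ _ (P (u k \+ r))).
  apply: P_le => // [|x]; first exact: C0pD.
  by rewrite /= /r maxEle; case: ifPn; lra.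
by rewrite PD//; have := ua k; lra.
Qed.

(** Each [F i] has a cover of cost at most [m (F i) + e / 2 ^ i.+1]; the diagonal sums of [u i k]
    over [i < k] cover the union. *)
Let outer_sigma_subadditive : sigma_subadditive daniell_outer.
Proof.
move=> F; rewrite /daniell_outer.
have mF0 i : (0 <= (m (F i))%:E)%E by rewrite lee_fin m_ge0.
set S := (\sum_(i <oo) _)%E.
have S0 : (0 <= S)%E by exact: nneseries_ge0.
have trick e : 0 < e ->
    (\sum_(i <oo) ((m (F i))%:E + (e / (2 ^ i.+1)%:R)%:E) <= S + e%:E)%E.
  by move=> /ltW; exact: epsilon_trick.
case: S S0 trick => [s s0 trick|_ _|//].
- rewrite lee_fin; apply/ler_addgt0Pr => e e0; have {}trick := trick _ e0.
  have e2 i : 0 < e / (2 ^ i.+1)%:R by rewrite divr_gt0// ltr0n expn_gt0.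
  have ex i : exists u : nat -> Xi -> R,
     [/\ forall k, C0p (u k), forall x m n, (m <= n)%N -> u m x <= u n x,
       forall k, P (u k) <= m (F i) + e / (2 ^ i.+1)%:R &
       forall x, F i x -> exists k, 1 <= u k x].
    have [a [u [Cu ndu ua uF]] aF] := m_approx (F i) (e2 i).
    by exists u; split=> // k; exact: le_trans (ua k) (ltW aF).
  have [u /all_and4[Cu ndu ua uF]] := choice ex.
  apply: m_le; exists (fun k x => \sum_(i < k) u i k x); split.
  + by move=> k; apply: C0p_sum => i; exact: Cu.
  + move=> x p q pq; rewrite -(subnKC pq) big_split_ord/= (subnKC pq).
    rewrite -[leLHS]addr0 lerD//; first by apply: ler_sum => i _; exact: ndu.
    by apply: sumr_ge0 => i _; exact: (Cu _ _).2.
  + move=> k; rewrite (P_sum k (F := fun i => u i k))//.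
    rewrite -lee_fin; apply: le_trans trick.
    apply: (@le_trans _ _ (\sum_(0 <= i < k)
        ((m (F i))%:E + (e / (2 ^ i.+1)%:R)%:E))%E).
      rewrite -sumEFin big_mkord; apply: lee_sum => i _.
      by rewrite -EFinD lee_fin.
    apply: nneseries_lim_ge => i _; rewrite -EFinD lee_fin.
    by rewrite addr_ge0// ltW.
  (* From index [i.+1] on, the cover of [F i] is among the summands; from index [k] on, it is at
     least 1 at [x]. *)
  + move=> x [i _ /uF[k uk]]; exists (maxn k i.+1).
    have ik : (i < maxn k i.+1)%N by rewrite leq_maxr.
    rewrite (bigD1 (Ordinal ik))//=; apply: ler_wpDr.
      by apply: sumr_ge0 => j _; exact: (Cu _ _).2.
    by apply: le_trans uk _; apply: ndu; exact: leq_maxl.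
- by rewrite leey.
Qed.

(* If w_k increases to the indicator of U, then a cover u_k of X splits into the
   cover u_k w_k of X `&` U and, for each fixed j, the cover u_k (1 - w_j) of
   X `\` U. *)
Let open_caratheodory U : open U ->
  forall X, m (X `&` U) + m (X `&` ~` U) <= m X.
Proof.
move=> oU X; apply/ler_addgt0Pr => e e0.
have [a [u [Cu ndu ua uX]] /ltW aX] := m_approx X e0.
apply: le_trans aX.
have [w [Cw w01 ndw wU Uw]] := @open_C0_approx R Xi scXi lcXi hausXi U oU.
have Cpw k : C0p (w k) by split=> // x; have /andP[] := w01 k x.
have Cuw k j : C0p (fun x => u k x * w j x) by exact: C0pM.
have Cv k j : C0p (u k \- (fun x => u k x * w j x)).
  apply: C0pB => // x; rewrite ler_piMr//; first exact: (Cu k).2.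
  by have /andP[] := w01 j x.
(* The cover is shifted by [j]: since [u j <= u (k + j)], the functions [u j * w j] and
   [u (k + j) * (1 - w j)] add up to at most [u (k + j)], on which [P] is at most [a]. *)
have le_j j : P (fun x => u j x * w j x) <= a - m (X `&` ~` U).
  rewrite lerBrDr -lerBrDl; apply: m_le.
  exists (fun k => u (k + j)%N \- (fun x => u (k + j)%N x * w j x)); split=> //.
  - move=> x p q pq /=; rewrite -[X in X - _]mulr1 -[X in _ <= X - _]mulr1.
    rewrite -!mulrBr ler_wpM2r//; last by rewrite ndu// leq_add2r.
    by rewrite subr_ge0; have /andP[] := w01 j x.
  - move=> k; rewrite lerBrDl.
    apply: (@le_trans _ _ (P (fun x => u (k + j)%N x * w j x) +
        P (u (k + j)%N \- (fun x => u (k + j)%N x * w j x)))).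
      rewrite lerD2r; apply: P_le => // x.
      by rewrite ler_wpM2r// ?ndu ?leq_addl//; exact: (Cpw j).2.
    rewrite -PD//; apply: le_trans (ua (k + j)%N).
    apply: P_le => // [|x]; first exact: C0pD.
    by rewrite /= addrC subrK.
  - move=> x [/uX[k uk] nUx]; exists k.
    by rewrite /= wU// mulr0 subr0 (le_trans uk)// ndu// leq_addr.
rewrite -lerBrDr; apply: m_le.
exists (fun k x => u k x * w k x); split=> //.
- by move=> x p q pq; rewrite ler_pM ?ndu ?ndw//; [exact: (Cu p).2|exact: (Cpw p).2].
- move=> x [/uX[k uk] /Uw[j wj]]; exists (maxn k j).
  rewrite -[leLHS]mulr1 ler_pM//.
    by rewrite (le_trans uk)// ndu// leq_maxl.
  by rewrite (le_trans wj)// ndw// leq_maxr.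
Qed.

(** Multiplying a cover by [1 + d] turns the closed condition [1 <= u k] into the open condition
    [1 < (1 + d) * u k], at the extra cost [d * a <= e / 2]. *)
Let outer_open A e : 0 < e ->
  exists U, [/\ open U, A `<=` U & m U <= m A + e].
Proof.
move=> e0; have e20 : 0 < e / 2 by rewrite divr_gt0.
have [a Aa aA] := m_approx A e20.
have a0 := cover_ge0 Aa; have [u [Cu ndu ua uA]] := Aa.
have a10 : 0 < 2 * (a + 1) by lra.
pose d := e / (2 * (a + 1)); have d0 : 0 < d by rewrite divr_gt0.
have da : d * a <= e / 2.
  by rewrite /d mulrAC ler_pdivrMr//; nra.
have d1 : 0 <= 1 + d by rewrite addr_ge0// ltW.
exists (\bigcup_k [set x | 1 < (1 + d) * u k x]); split.
- apply: bigcup_open => k _; apply: open_gt_continuous.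
  by move=> x; apply: cvgM; [exact: cvg_cst|exact: (Cu k).1.1].
- by move=> x /uA[k uk]; exists k => //=; nra.
- apply: (@le_trans _ _ ((1 + d) * a)); last by lra.
  apply: m_le; exists (fun k x => (1 + d) * u k x); split.
  + by move=> k; exact: C0pZ.
  + by move=> x p q pq; rewrite ler_wpM2l// ndu.
  + by move=> k; rewrite PZ// ler_wpM2l.
  + by move=> x [k _ /= /ltW ?]; exists k.
Qed.

(** Caratheodory's construction: open sets are measurable by [open_caratheodory], hence so are all
    Borel sets. The measure is finite because [daniell_outer] is real-valued. *)
Let daniell_measure : exists mu : {finite_measure set (borel Xi) -> \bar R},
  forall A, mu A = (m A)%:E.
Proof.
pose OM := isOuterMeasure.Build R Xi daniell_outer
  (congr1 EFin m0) (fun A => m_ge0 A) (fun A B AB => m_mono AB)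
  outer_sigma_subadditive.
pose om : {outer_measure set Xi -> \bar R} := HB.pack daniell_outer OM.
have sub : (measurable : set (set (borel Xi))) `<=` om.-caratheodory.
  apply: smallest_sub.
    split.
    - exact: caratheodory_measurable_set0.
    - by move=> A; rewrite setTD; exact: caratheodory_measurable_setC.
    - exact: caratheodory_measurable_bigcup.
  move=> U oU; apply: le_caratheodory_measurable => X.
  by rewrite -EFinD lee_fin open_caratheodory.
have sadd : semi_sigma_additive (daniell_outer : set (borel Xi) -> \bar R).
  move=> F mF tF mUF.
  by apply: (@caratheodory_measure_sigma_additive R Xi om) => // [i|]; exact: sub.
pose B1 := isMeasure.Build _ _ _ (daniell_outer : set (borel Xi) -> \bar R)
  (congr1 EFin m0) (fun A => m_ge0 A) sadd.
pose mu1 : {measure set (borel Xi) -> \bar R} :=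
  HB.pack (daniell_outer : set (borel Xi) -> \bar R) B1.
pose B2 := Measure_isFinite.Build _ _ _ mu1 (fun A _ => isT).
pose mu : {finite_measure set (borel Xi) -> \bar R} :=
  HB.pack (daniell_outer : set (borel Xi) -> \bar R) B1 B2.
by exists mu.
Qed.

(** Let [U] and [V] be open sets slightly larger than [A] and its complement. The complement of [V]
    is a closed subset of [A], made compact by intersecting it with some [w n >= 1 / 2]. The
    complements [D n] of these superlevel sets decrease to the empty set, so their measure tends to
    0. Three errors of [e / 4] result. *)
Let measure_regular (mu : {finite_measure set (borel Xi) -> \bar R}) :
  (forall A, mu A = (m A)%:E) -> inner_outer_regular mu.
Proof.
move=> muE A e mA e0; have e40 : 0 < e / 4 by rewrite divr_gt0.
have muD (B U : set Xi) : measurable (B : set (borel Xi)) -> open U ->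
    B `<=` U -> m U <= m B + e / 4 -> (mu (U `\` B) <= (e / 4)%:E)%E.
  move=> mB oU BU mUB; rewrite measureD//; last 2 first.
  - exact: open_borel.
  - by rewrite ltey_eq fin_num_measure//; exact: open_borel.
  rewrite (_ : U `&` B = B); last exact/setIidPr.
  by rewrite [X in (X - _)%E]muE [X in (_ - X)%E]muE -EFinB lee_fin; lra.
have [U [oU AU mU]] := outer_open A e40.
have [V [oV AV mV]] := outer_open (~` A) e40.
have UA := muD _ _ mA oU AU mU.
have VA := muD _ _ (measurableC mA) oV AV mV.
have [w [Cw w01 ndw _ wT]] := @open_C0_approx R Xi scXi lcXi hausXi setT openT.
pose D n := ~` [set x | 1 / 2 <= w n x].
have cD n : compact (~` D n) by rewrite setCK; apply: compact_C0_superlevel => //; lra.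
have mD n : measurable (D n : set (borel Xi)).
  by apply: measurableC; apply: closed_borel; rewrite -(setCK [set _ | _]); exact: (compact_closed hausXi (cD n)).
have [n Dn] : exists n, (mu (D n) < (e / 4)%:E)%E.
  have : mu (D n) @[n --> \oo] --> mu (\bigcap_n D n).
    apply: nonincreasing_cvg_mu => //.
    - by rewrite ltey_eq fin_num_measure.
    - exact: bigcap_measurable.
    - move=> p q pq; apply/subsetPset => x /= Dq Dp; apply: Dq.
      exact: le_trans Dp (ndw _ _ _ pq).
  rewrite (_ : \bigcap_n D n = set0); last first.
    apply/seteqP; split=> // x Dx; have [n wn] := wT x Logic.I.
    by apply: (Dx n) => //=; lra.
  rewrite measure0 => /fine_cvgP[_ /cvgr_lt /(_ _ e40)[N _ /(_ N (leqnn N)) /= DN]].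
  exists N; rewrite -[ltLHS]fineK; last exact: fin_num_measure.
  by rewrite lte_fin.
exists (~` D n `&` ~` V), U; split=> //.
- apply: compact_closedI => //; exact: open_closedC.
- by move=> x [_ nV]; apply: contrapT => /AV.
apply: (@le_lt_trans _ _ (mu ((U `\` A) `|` (V `\` ~` A) `|` D n))).
  have mU' := open_borel oU; have mV' := open_borel oV.
  have mK : measurable (~` D n `&` ~` V : set (borel Xi)).
    by apply: measurableI; apply: measurableC.
  apply: le_measure; rewrite ?inE.
  - exact: measurableD.
  - apply: measurableU => //; apply: measurableU; apply: measurableD => //.
    exact: measurableC.
  move=> x [Ux nK]; have [Dx|nDx] := pselect (D n x); first by right.
  left; have [Ax|nAx] := pselect (A x); last by left.
  by right; split=> //; apply: contrapT => nVx; exact: nK.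
have mU' := open_borel oU; have mV' := open_borel oV.
have m1 : measurable (U `\` A : set (borel Xi)) by exact: measurableD.
have m2 : measurable (V `\` ~` A : set (borel Xi)).
  by apply: measurableD => //; exact: measurableC.
have m12 : measurable ((U `\` A) `|` (V `\` ~` A) : set (borel Xi)).
  exact: measurableU.
apply: (le_lt_trans (measureU2 _ _ _)) => //.
apply: (@le_lt_trans _ _ ((e / 4)%:E + (e / 4)%:E + (e / 4)%:E)%E).
  apply: leeD; last exact: ltW.
  by apply: (le_trans (measureU2 _ _ _)) => //; exact: leeD.
by rewrite -!EFinD lte_fin; lra.
Qed.

(* For the slice c = min h e, both P c and the integral of c lie between
   e * m {h > e} and e * m {h > 0}; these bounds telescope over the slices. *)
Let layer_cake (mu : {finite_measure set (borel Xi) -> \bar R}) e n h :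
  (forall A, mu A = (m A)%:E) -> 0 < e -> C0p h ->
  (forall x, h x <= n%:R * e) ->
  `|\int[mu]_x h x - P h| <= e * m [set x | 0 < h x].
Proof.
move=> muE e0; elim: n h => [|n IH] h Ch hn.
  have -> : h = fun=> 0.
    apply/funext => x; apply/eqP; rewrite eq_le Ch.2 andbT.
    by rewrite -(mul0r e) hn.
  by rewrite P0 Rintegral_cst// mul0r subr0 normr0 mulr_ge0// ltW.
pose c x := Num.min (h x) e; pose h' x := Num.max 0 (h x - e).
have hE : h = c \+ h'.
  apply/funext => x; rewrite /c /h' /= minEle maxEle.
  by case: ifPn => ?; case: ifPn => ?; lra.
have Cc : C0p c.
  apply: (@C0p_le _ _ 1 h) => // x.
    by apply: continuous_fmin => y; [exact: Ch.1.1|exact: cvg_cst].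
  by rewrite le_min Ch.2 (ltW e0) mul1r ge_min lexx.
have Ch' : C0p h'.
  apply: (@C0p_le _ _ 1 h) => // x.
    apply: continuous_fmax => y; first exact: cvg_cst.
    by apply: cvgB; [exact: Ch.1.1|exact: cvg_cst].
  by rewrite le_max lexx mul1r ge_max Ch.2/=; lra.
have h'n x : h' x <= n%:R * e.
  rewrite ge_max mulr_ge0 ?(ltW e0)//=.
  by have := hn x; rewrite -natr1; lra.
have {}IH := IH _ Ch' h'n.
pose A := [set x | 0 < h x]; pose B := [set x | 0 < h' x].
have oA : open A by apply: open_gt_continuous Ch.1.1.
have oB : open B by apply: open_gt_continuous Ch'.1.1.
have ce x : c x = e * (e^-1 * c x) by rewrite mulrA divff ?mul1r ?gt_eqF.
have Cec : C0p (fun x => e^-1 * c x) by apply: C0pZ; rewrite ?invr_ge0 ?ltW.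
have cA x : ~ A x -> c x = 0.
  move=> nA; have h0 : h x = 0.
    by apply/eqP; rewrite eq_le Ch.2 andbT leNgt; apply/negP.
  by rewrite /c h0 min_l// ltW.
have cB x : B x -> c x = e.
  by rewrite /B/= lt_max ltxx/= subr_gt0 => /ltW; exact: min_r.
have PcE : P c = e * P (fun x => e^-1 * c x).
  by rewrite -PZ ?ltW//; congr P; apply/funext.
have PcA : P c <= e * m A.
  rewrite PcE ler_wpM2l ?(ltW e0)//; apply: P_le_m => // x.
    by rewrite mulrC ler_pdivrMr// mul1r ge_min lexx orbT.
  by move=> /cA ->; rewrite mulr0.
have PcB : e * m B <= P c.
  rewrite PcE ler_wpM2l ?(ltW e0)//; apply: m_le_P => // x /cB ->.
  by rewrite mulVf ?gt_eqF.
have int f : C0p f -> mu.-integrable setT (EFin \o (f : borel Xi -> R)).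
  by move=> Cf; exact: C0_integrable Cf.1.
have intI (U : set Xi) : open U ->
    mu.-integrable setT (EFin \o (fun x : borel Xi => e * \1_U x)).
  move=> oU; have mU := open_borel oU.
  apply: (@bounded_integrable _ _ _ _ e) => //.
    by apply: measurable_funM => //; exact: measurable_indic.
  move=> x; rewrite indicE; case: (_ \in _); rewrite ?mulr1 ?mulr0 ?normr0.
    by rewrite gtr0_norm.
  exact: ltW.
have IcA : \int[mu]_x c x <= e * m A.
  rewrite -[m A]/(fine (m A)%:E) -muE -Rintegral_indicZ; last exact: open_borel.
  apply: le_Rintegral => //; [exact: int|exact: intI|].
  move=> x _; rewrite indicE; case: (boolP (x \in A)) => [_|].
    by rewrite mulr1 ge_min lexx orbT.
  by rewrite notin_setE => /cA ->; rewrite mulr0.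
have IcB : e * m B <= \int[mu]_x c x.
  rewrite -[m B]/(fine (m B)%:E) -muE -Rintegral_indicZ; last exact: open_borel.
  apply: le_Rintegral => //; [exact: intI|exact: int|].
  move=> x _; rewrite indicE; case: (boolP (x \in B)) => [|_].
    by rewrite inE => /cB ->; rewrite mulr1.
  by rewrite mulr0; exact: Cc.2.
have -> : P h = P c + P h' by rewrite -PD// -hE.
have -> : \int[mu]_x h x = \int[mu]_x c x + \int[mu]_x h' x.
  rewrite -RintegralD//; [|exact: int|exact: int].
  by apply: eq_Rintegral => x _; rewrite [in LHS]hE.
(* Both values for the slice [c] lie in the interval from [e * m B] to [e * m A], and the error for
   [h'] is at most [e * m B]; together at most [e * m A]. *)
move: IH; rewrite -/A -/B;
move: (m A) (m B) (P c) (P h') (\int[mu]_x c x) (\int[mu]_x h' x) PcA PcB IcA IcB.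
move=> a b p q i j ? ? ? ?.
by rewrite !ler_norml => /andP[? ?]; apply/andP; split; lra.
Qed.

(** [layer_cake] with slices of height [d = e / (M + 1)], as many as the bound of [g] requires: the
    error is at most [d * M], whatever the number of slices. *)
Theorem positive_riesz : exists mu : {finite_measure set (borel Xi) -> \bar R},
  (forall g, C0p g -> \int[mu]_x g x = P g) /\ inner_outer_regular mu.
Proof.
have [mu muE] := daniell_measure; exists mu; split; last exact: measure_regular.
move=> g Cg; apply/eqP; rewrite -subr_eq0 -normr_le0.
apply/ler_addgt0Pr => e e0; rewrite add0r.
have M10 : 0 < M + 1 by have := M_ge0; lra.
pose d := e / (M + 1); have d0 : 0 < d by rewrite divr_gt0.
have [B B0 gB] := C0_bounded Cg.1.
pose n := (Num.truncn (B / d)).+1.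
have gn x : g x <= n%:R * d.
  rewrite -ler_pdivrMr// (le_trans _ (ltW (truncnS_gt _)))//.
  by rewrite ler_pM2r ?invr_gt0// (le_trans (ler_norm _)).
apply: (le_trans (layer_cake muE d0 Cg gn)).
apply: (@le_trans _ _ (d * M)).
  by rewrite ler_wpM2l ?(ltW d0)// m_le.
rewrite /d mulrAC ler_pdivrMr//; nra.
Qed.

End positive_riesz.

(** * Riesz representation of bounded functionals *)

Section charges.
Context {R : realType} {Xi : ptopologicalType}.
Implicit Types (nu : {charge set (borel Xi) -> \bar R}).

(** [jpos] and [jneg] are typed as mere measures. This recovers their finiteness, needed for
    integrability, and a positive set [D] of the Hahn decomposition. *)
Lemma jordan_of_charge nu :
  exists (p q : {finite_measure set (borel Xi) -> \bar R}) (D : set (borel Xi)),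
  [/\ jpos nu = p, jneg nu = q, measurable D,
     forall A, measurable A -> p A = nu (A `&` D) &
     forall A, measurable A -> q A = (- nu (A `\` D))%E].
Proof.
set PN := hahn_proof nu.
exists (jordan_pos PN : {finite_measure set (borel Xi) -> \bar R}).
exists (jordan_neg PN : {finite_measure set (borel Xi) -> \bar R}).
have [[mP _] [mN _] PUN PIN] := PN.
exists (projT1 (cid (Hahn_decomposition nu))); split=> // A mA.
  transitivity (jordan_pos PN A) => //.
  by rewrite jordan_posE cjordan_posE /crestr0 mem_set.
transitivity (jordan_neg PN A) => //.
rewrite jordan_negE cjordan_negE /crestr0 mem_set// /crestr; congr (- nu _)%E.
apply/seteqP; split=> x [Ax].
  by move=> Nx; split=> // Px; have : set0 x by rewrite -PIN.
by move=> nPx; split=> //; have : setT x by []; rewrite -PUN => -[].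
Qed.

(** Stated with sums, since a difference of measures is not a measure; it compares two ways of
    writing one charge as such a difference. *)
Lemma Rintegral_measureD (m1 m2 n1 n2 : {finite_measure set (borel Xi) -> \bar R})
    (g : borel Xi -> R) :
  (forall A, measurable A -> (m1 A + m2 A = n1 A + n2 A)%E) ->
  (forall mu : {finite_measure set (borel Xi) -> \bar R},
     mu.-integrable setT (EFin \o g)) ->
  \int[m1]_x g x + \int[m2]_x g x = \int[n1]_x g x + \int[n2]_x g x.
Proof.
move=> mn ig.
have int (a b : {finite_measure set (borel Xi) -> \bar R}) :
    \int[a]_x g x + \int[b]_x g x = fine (\int[measure_add a b]_x (g x)%:E)%E.
  rewrite (integral_measure_add measurableT (ig a) (ig b)).
  rewrite fineD//.
  - exact: (integrable_fin_num measurableT (ig a)).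
  - exact: (integrable_fin_num measurableT (ig b)).
rewrite !int; congr fine; apply: eq_measure_integral => A mA _.
exact: etrans (measure_addE _ _ _)
  (etrans (mn A mA) (esym (measure_addE _ _ _))).
Qed.

(** [m1] and [m2] may overlap, so they need not be the Jordan parts [p], [q] of [nu = m1 - m2].
    Still [p + m2 = q + m1] on the Borel sets, so that the integrals agree. *)
Lemma charge_of_measures (m1 m2 : {finite_measure set (borel Xi) -> \bar R}) :
  inner_outer_regular m1 -> inner_outer_regular m2 ->
  hausdorff_space Xi ->
  exists nu : {charge set (borel Xi) -> \bar R}, radon nu /\
    forall g, C0 g -> charge_integral nu g = \int[m1]_x g x - \int[m2]_x g x.
Proof.
move=> reg1 reg2 hausXi.
pose nu : {charge set (borel Xi) -> \bar R} :=
  cadd (charge_of_finite_measure m1) (cscale (-1) (charge_of_finite_measure m2)).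
have nuE A : nu A = (m1 A - m2 A)%E by rewrite /= /cadd /= /cscale EFinN mulN1e.
have [p [q [D [pE qE mD pD qD]]]] := jordan_of_charge nu.
have mfin (m : {finite_measure set (borel Xi) -> \bar R}) A :
    measurable A -> exists r, m A = r%:E.
  by move=> mA; exists (fine (m A)); rewrite fineK// fin_num_measure.
have mle (m : {finite_measure set (borel Xi) -> \bar R}) A B :
    measurable A -> measurable B -> A `<=` B -> (m A <= m B)%E.
  by move=> mA mB AB; apply: le_measure => //; apply: mem_set.
exists nu; split=> [A e mA e0|g Cg].
  have e20 : 0 < e / 2 by rewrite divr_gt0.
  have [K1 [U1 [cK1 oU1 K1A AU1 UK1]]] := reg1 _ _ mA e20.
  have [K2 [U2 [cK2 oU2 K2A AU2 UK2]]] := reg2 _ _ mA e20.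
  have mK1 : measurable (K1 : set (borel Xi)).
    by apply: closed_borel; exact: compact_closed.
  have mK2 : measurable (K2 : set (borel Xi)).
    by apply: closed_borel; exact: compact_closed.
  have mU1 := open_borel oU1; have mU2 := open_borel oU2.
  exists (K1 `|` K2), (U1 `&` U2); split.
  - exact: compactU.
  - exact: openI.
  - by move=> x [/K1A|/K2A].
  - by move=> x Ax; split; [exact: AU1|exact: AU2].
  have mUK : measurable ((U1 `&` U2) `\` (K1 `|` K2) : set (borel Xi)).
    by apply: measurableD; [exact: measurableI|exact: measurableU].
  rewrite /abs_charge /charge_variation /=.
  change (jpos nu ((U1 `&` U2) `\` (K1 `|` K2)) +
    jneg nu ((U1 `&` U2) `\` (K1 `|` K2)) < e%:E)%E.
  rewrite pE qE [X in (X + _ < _)%E](pD _ mUK) [X in (_ + X < _)%E](qD _ mUK).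
  rewrite !nuE.
  (* The variation of [nu] on the difference of the open and the compact set is
     [nu E - nu F <= m1 E + m2 F]; both terms are below [e / 2] by the regularity of [m1] and
     [m2]. *)
  set E := _ `&` D; set F := _ `\` D.
  have mE : measurable E by exact: measurableI.
  have mF : measurable F by exact: measurableD.
  have E1 : (m1 E <= m1 (U1 `\` K1))%E.
    apply: mle => //; first exact: measurableD.
    by move=> x [[[U1x _] nK] _]; split=> // K1x; apply: nK; left.
  have F2 : (m2 F <= m2 (U2 `\` K2))%E.
    apply: mle => //; first exact: measurableD.
    by move=> x [[[_ U2x] nK] _]; split=> // K2x; apply: nK; right.
  have := le_lt_trans E1 UK1; have := le_lt_trans F2 UK2.
  have [a aE] := mfin m1 _ mE; have [b bE] := mfin m2 _ mE.
  have [c cE] := mfin m1 _ mF; have [d dE] := mfin m2 _ mF.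
  have : (0 <= b%:E)%E by rewrite -bE; exact: measure_ge0.
  have : (0 <= c%:E)%E by rewrite -cE; exact: measure_ge0.
  rewrite aE bE cE dE !lte_fin !lee_fin.
  lra.
rewrite /charge_integral pE qE.
have ig (mu : {finite_measure set (borel Xi) -> \bar R}) :
    mu.-integrable setT (EFin \o (g : borel Xi -> R)) by exact: C0_integrable.
have := @Rintegral_measureD p m2 q m1 g.
have pm A : measurable A -> (p A + m2 A = q A + m1 A)%E.
  move=> mA; have DI : nu A = (nu (A `\` D) + nu (A `&` D))%E := chargeDI nu mA mD.
  have nufin B : measurable B -> exists r, nu B = r%:E.
    by move=> mB; exists (fine (nu B)); rewrite fineK// fin_num_measure.
  have [r rE] := nufin _ (measurableI _ _ mA mD).
  have [s sE] := nufin _ (measurableD mA mD).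
  have [a aE] := mfin m1 _ mA; have [b bE] := mfin m2 _ mA.
  move: DI; rewrite nuE (pD _ mA) (qD _ mA) rE sE aE bE => -[E].
  by congr (_%:E); move: E; lra.
by move=> /(_ pm ig); lra.
Qed.

End charges.

Section signed_riesz.
Context {R : realType} {Xi : ptopologicalType}.
Hypotheses (scXi : @second_countable Xi) (lcXi : locally_compact [set: Xi])
  (hausXi : hausdorff_space Xi).
Variables (F : (Xi -> R) -> R) (M : R).
Hypothesis FD : forall f g, C0 f -> C0 g -> F (f \+ g) = F f + F g.
Hypothesis FZ : forall c g, C0 g -> F (fun x => c * g x) = c * F g.
Hypothesis F_bound : forall c g, C0 g -> (forall x, `|g x| <= c) ->
  `|F g| <= M * c.
Implicit Types (g h : Xi -> R) (c : R).

(** The supremum [P] of these values is the positive part of [F]. *)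
Let S g := [set F h | h in [set h | C0p h /\ forall x, h x <= g x]].
Let P g := sup (S g).

Let F0 : F (fun=> 0) = 0.
Proof.
have := @FZ 0 _ (@C0_cst0 R Xi); rewrite [X in _ = X]mul0r => E; rewrite -[RHS]E.
by congr F; apply/funext => x; rewrite mul0r.
Qed.

Let M_ge0 : 0 <= M.
Proof.
have := @F_bound 1 _ (@C0_cst0 R Xi); rewrite F0 normr0 mulr1; apply.
by move=> x; exact: ler01.
Qed.

Let F_le c g h : C0p h -> (forall x, h x <= g x) -> (forall x, g x <= c) ->
  F h <= M * c.
Proof.
move=> [Ch h0] hg gc; apply: le_trans (ler_norm _) _; apply: F_bound => // x.
by rewrite ger0_norm// (le_trans (hg x)).
Qed.

Let S_sup g : C0p g -> has_sup (S g).
Proof.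
move=> [Cg g0]; split.
  by exists 0, (fun=> 0); [split=> //; exact: C0p_cst0|exact: F0].
have [c c0 gc] := C0_bounded Cg; exists (M * c) => _ [h [Ch hg] <-].
by apply: (F_le Ch hg) => x; exact: le_trans (ler_norm _) (gc x).
Qed.

Let F_leP g h : C0p g -> C0p h -> (forall x, h x <= g x) -> F h <= P g.
Proof.
by move=> Cg Ch hg; apply: sup_upper_bound; [exact: S_sup|exists h].
Qed.

Let P_le g c : C0p g -> (forall h, C0p h -> (forall x, h x <= g x) -> F h <= c) ->
  P g <= c.
Proof.
move=> Cg hc; apply: ge_sup; first exact: (S_sup Cg).1.
by move=> _ [h [Ch hg] <-]; exact: hc.
Qed.

Let P_ge0 g : C0p g -> 0 <= P g.
Proof. by move=> Cg; rewrite -F0; apply: F_leP => //; [exact: C0p_cst0|exact: Cg.2]. Qed.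

Let P_bound c g : C0p g -> (forall x, g x <= c) -> P g <= M * c.
Proof. by move=> Cg gc; apply: P_le => // h Ch hg; exact: (F_le Ch hg). Qed.

(** One inequality, proved for all positive factors, suffices: applied to [c^-1] and [c * g] it
    gives the other one. *)
Let PZ c g : 0 <= c -> C0p g -> P (fun x => c * g x) = c * P g.
Proof.
have le_PZ b f : 0 < b -> C0p f -> P (fun x => b * f x) <= b * P f.
  move=> b0 Cf; have Cbf : C0p (fun x => b * f x) by apply: C0pZ => //; exact: ltW.
  have Vb0 : 0 <= b^-1 by rewrite invr_ge0 ltW.
  apply: P_le => // h Ch hf.
  rewrite -ler_pdivrMl// -FZ; last exact: Ch.1.
  apply: F_leP => //; first exact: C0pZ.
  by move=> x; rewrite ler_pdivrMl.
rewrite le_eqVlt => /predU1P[<- Cg|c0 Cg].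
  apply/eqP; rewrite eq_le mul0r; apply/andP; split.
    apply: (@le_trans _ _ (M * 0)); last by rewrite mulr0.
    apply: P_bound => [|x]; last by rewrite mul0r.
    exact: C0pZ.
  by apply: P_ge0; exact: C0pZ.
have Ccg : C0p (fun x => c * g x) by apply: C0pZ => //; exact: ltW.
apply/eqP; rewrite eq_le le_PZ//= -ler_pdivlMl//.
rewrite [X in P X <= _](_ : g = fun x => c^-1 * (c * g x)).
  by apply: le_PZ => //; rewrite invr_gt0.
by apply/funext => x; rewrite mulKf// gt_eqF.
Qed.

(* Riesz decomposition: [0 <= h <= f + g] splits as [h = min h f + (h - min h f)]. *)
Let PD f g : C0p f -> C0p g -> P (f \+ g) = P f + P g.
Proof.
move=> Cf Cg; have Cfg := C0pD Cf Cg.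
apply/eqP; rewrite eq_le; apply/andP; split.
  apply: P_le => // h Ch hfg.
  pose h1 x := Num.min (h x) (f x).
  have Ch1 : C0p h1.
    apply: (@C0p_le _ _ 1 h) => // x.
      by apply: continuous_fmin; [exact: Ch.1.1|exact: Cf.1.1].
    by rewrite le_min Ch.2 Cf.2 mul1r ge_min lexx.
  have Ch2 : C0p (h \- h1) by apply: C0pB => // x; rewrite ge_min lexx.
  rewrite (_ : h = h1 \+ (h \- h1)); last first.
    by apply/funext => x /=; rewrite addrC subrK.
  rewrite FD//; [|exact: Ch1.1|exact: Ch2.1].
  apply: lerD; apply: F_leP => // x; first by rewrite ge_min lexx orbT.
  have := Cg.2 x; have := hfg x.
  by rewrite /= /h1 minEle; case: ifPn; lra.
rewrite -lerBrDr; apply: P_le => // h1 Ch1 h1f.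
rewrite lerBrDr -lerBrDl; apply: P_le => // h2 Ch2 h2g.
rewrite lerBrDl -FD; [|exact: Ch1.1|exact: Ch2.1].
apply: F_leP => //; first exact: C0pD.
by move=> x; exact: lerD.
Qed.

Theorem signed_riesz : exists nu : {charge set (borel Xi) -> \bar R},
  radon nu /\ forall g, C0 g -> charge_integral nu g = F g.
Proof.
(* [Q] is the negative part of [F], nonnegative because [g] itself competes in the supremum [P g].
   Both parts are represented by measures, and [F = P - Q]. *)
pose Q g := P g - F g.
have Q_ge0 g : C0p g -> 0 <= Q g by move=> Cg; rewrite subr_ge0; exact: F_leP.
have QD f g : C0p f -> C0p g -> Q (f \+ g) = Q f + Q g.
  move=> Cf Cg; rewrite /Q PD// FD; [|exact: Cf.1|exact: Cg.1].
  by rewrite opprD addrACA.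
have QZ c g : 0 <= c -> C0p g -> Q (fun x => c * g x) = c * Q g.
  by move=> c0 Cg; rewrite /Q PZ// FZ ?mulrBr//; exact: Cg.1.
have Q_bound c g : C0p g -> (forall x, g x <= c) -> Q g <= (M + M) * c.
  move=> Cg gc; rewrite mulrDl lerD ?P_bound//.
  rewrite (le_trans (ler_norm _))// normrN F_bound//; first exact: Cg.1.
  by move=> x; rewrite ger0_norm//; exact: Cg.2.
have [m1 [m1E m1r]] := positive_riesz scXi lcXi hausXi P_ge0 PD PZ P_bound.
have [m2 [m2E m2r]] := positive_riesz scXi lcXi hausXi Q_ge0 QD QZ Q_bound.
have [nu [rnu nuE]] := charge_of_measures m1r m2r hausXi.
exists nu; split=> // g Cg; rewrite nuE//.
(* The measures represent [P] and [Q] on nonnegative functions only, so [g] is split into its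
   positive and negative parts. *)
pose gp x := Num.max 0 (g x); pose gn x := gp x - g x.
have Cgp : C0p gp.
  split; last by move=> x; rewrite le_max lexx.
  apply: (@C0_le _ _ 1 g) => // x.
    by apply: continuous_fmax => y; [exact: cvg_cst|exact: Cg.1].
  rewrite mul1r /gp maxEle; case: ifPn => _; first exact: lexx.
  by rewrite normr0.
have Cgn : C0p gn.
  split; first exact: (C0B Cgp.1 Cg).
  by move=> x; rewrite /gn /gp maxEle; case: ifPn; lra.
have gE : gp = g \+ gn by apply/funext => x; rewrite /gn /= addrC subrK.
have int (mu : {finite_measure set (borel Xi) -> \bar R}) :
    \int[mu]_x gp x = \int[mu]_x g x + \int[mu]_x gn x.
  rewrite -RintegralD//; [|exact: C0_integrable|apply: C0_integrable => //; exact: Cgn.1].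
  by apply: eq_Rintegral => x _; rewrite gE.
have := int m1; have := int m2; have : F gp = F g + F gn.
  by rewrite gE FD//; exact: Cgn.1.
rewrite (m1E _ Cgp) (m1E _ Cgn) (m2E _ Cgp) (m2E _ Cgn) /Q.
move: (F gp) (F g) (F gn) (P gp) (P gn) (\int[m1]_x g x) (\int[m2]_x g x).
by clear gp gn Cgp Cgn gE int => *; lra.
Qed.

End signed_riesz.

(** * The dual norm *)

Section dual_norm.
Context {R : realType} {X : metricType R} {Xi : ptopologicalType}.
Variable kappa : X -> Xi -> R.
Implicit Types (s t : seq (R * X)) (f v : X -> R).

(** Formal combinations are lists, so that addition is concatenation. That [lincomb f s] depends
    only on the function [kernel_comb s] is a consequence of a finite [dual_norm f], by
    [lincomb_bound]. *)
Definition lincomb v s : R := \sum_(p <- s) p.1 * v p.2.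

Definition scale_comb (c : R) s := [seq (c * p.1, p.2) | p <- s].

Lemma lincomb_scale v c s : lincomb v (scale_comb c s) = c * lincomb v s.
Proof.
by rewrite /lincomb big_map mulr_sumr; apply: eq_bigr => p _; rewrite mulrA.
Qed.

Lemma lincomb_cat v s t : lincomb v (s ++ t) = lincomb v s + lincomb v t.
Proof. by rewrite /lincomb big_cat. Qed.

Lemma lincomb_nil v : lincomb v [::] = 0.
Proof. by rewrite /lincomb big_nil. Qed.

Definition kernel_comb s : Xi -> R := fun xi => lincomb (kappa^~ xi) s.

Lemma kernel_comb_scale c s xi :
  kernel_comb (scale_comb c s) xi = c * kernel_comb s xi.
Proof. exact: lincomb_scale. Qed.

Lemma kernel_comb_cat s t xi :
  kernel_comb (s ++ t) xi = kernel_comb s xi + kernel_comb t xi.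
Proof. exact: lincomb_cat. Qed.

(* The norm of the functional [kernel_comb s |-> lincomb f s] on the span of the
   kernel, which is [+oo] when this functional is unbounded or ill-defined. *)
Definition dual_norm f : \bar R := ereal_sup
  [set (lincomb f s)%:E | s in [set s | forall xi, `|kernel_comb s xi| <= 1]].

Lemma lincomb_le_dual_norm f s : (forall xi, `|kernel_comb s xi| <= 1) ->
  ((lincomb f s)%:E <= dual_norm f)%E.
Proof. by move=> s1; apply: ereal_sup_ubound; exists s. Qed.

Lemma dual_norm_ge0 f : (0 <= dual_norm f)%E.
Proof.
have := @lincomb_le_dual_norm f [::]; rewrite lincomb_nil; apply => xi.
by rewrite /kernel_comb lincomb_nil normr0.
Qed.

(** Rescaling by [d^-1], with either sign, makes the combination admissible in the supremum. *)
Lemma lincomb_bound f (M d : R) s : dual_norm f = M%:E -> 0 < d ->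
  (forall xi, `|kernel_comb s xi| <= d) -> `|lincomb f s| <= M * d.
Proof.
move=> fM d0 sd.
have le (c : R) : `|c| = 1 -> c * lincomb f s <= M * d.
  move=> c1; have := @lincomb_le_dual_norm f (scale_comb (c * d^-1) s).
  rewrite fM lincomb_scale lee_fin mulrAC ler_pdivrMr//; apply=> xi.
  rewrite kernel_comb_scale !normrM c1 mul1r normfV (gtr0_norm d0) mulrC.
  by rewrite ler_pdivrMr// mul1r.
rewrite ler_norml -[lincomb f s]mul1r le ?normr1// andbT lerNl -mulNr.
by rewrite le// normrN1.
Qed.

Section extension.
Hypothesis kernel_kappa : irkbs_kernel kappa.
Variables (f : X -> R) (M : R).
Hypothesis fM : dual_norm f = M%:E.

Let M_ge0 : 0 <= M.
Proof. by rewrite -lee_fin -fM dual_norm_ge0. Qed.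

Definition approx (g : Xi -> R) s (d : R) :=
  0 < d /\ forall xi, `|g xi - kernel_comb s xi| <= d.

Let approx_ex g d : C0 g -> 0 < d -> exists s, approx g s d.
Proof.
move=> Cg d0; have [_ [s _ <-] gs] := kernel_kappa.2 g Cg d d0.
exists s; split=> // xi; rewrite -lee_fin; apply: le_trans (ltW gs).
by apply: ereal_sup_ubound; exists xi.
Qed.

(** The combination [t - s] is bounded by [d + d'], so [lincomb_bound] applies to it. *)
Let approx_close g s t d d' : approx g s d -> approx g t d' ->
  lincomb f t <= lincomb f s + M * (d + d').
Proof.
move=> [d0 gs] [d'0 gt]; rewrite -lerBlDl.
have := @lincomb_bound f M (d + d') (t ++ scale_comb (-1) s) fM (addr_gt0 d0 d'0).
rewrite lincomb_cat lincomb_scale mulN1r => H.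
apply: le_trans (ler_norm _) _; apply: H => xi.
rewrite kernel_comb_cat kernel_comb_scale mulN1r.
rewrite (_ : _ - _ = (g xi - kernel_comb s xi) - (g xi - kernel_comb t xi)); last ring.
by rewrite (le_trans (ler_normB _ _))// lerD.
Qed.

(* Extension of [kernel_comb s |-> lincomb f s] to C_0, by density. *)
Let F g := sup [set r | exists s d, approx g s d /\ r = lincomb f s - M * d].

(** By [approx_close] every left end [lincomb f s - M * d] lies below every right end
    [lincomb f t + M * d']; the supremum of the left ends lies in all these intervals. *)
Let F_close g s d : C0 g -> approx g s d -> `|F g - lincomb f s| <= M * d.
Proof.
move=> Cg gs; have ub r : (exists t d', approx g t d' /\ r = lincomb f t - M * d') ->
    r <= lincomb f s + M * d.
  by move=> [t [d' [gt ->]]]; have := approx_close gs gt; rewrite mulrDr; lra.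
have in_s : exists t d', approx g t d' /\ lincomb f s - M * d = lincomb f t - M * d'.
  by exists s, d.
have le1 : F g <= lincomb f s + M * d by apply: ge_sup => //; exists (lincomb f s - M * d).
have le2 : lincomb f s - M * d <= F g.
  apply: sup_upper_bound => //; split; first by exists (lincomb f s - M * d).
  by exists (lincomb f s + M * d) => r; exact: ub.
by rewrite ler_norml; apply/andP; split; lra.
Qed.

Let eq_of_close (a b c : R) : (forall d, 0 < d -> `|a - b| <= c * d) -> a = b.
Proof.
move=> ab; apply/eqP; rewrite -subr_eq0 -normr_le0; apply/ler_addgt0Pr => e e0.
have c0 : 0 < `|c| + 1 by rewrite ltr_wpDl.
rewrite add0r (le_trans (ab _ (divr_gt0 e0 c0)))// mulrA ler_pdivrMr// mulrC.
by rewrite ler_wpM2l ?(ltW e0)// (le_trans (ler_norm c))// lerDl.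
Qed.

Let FD g h : C0 g -> C0 h -> F (g \+ h) = F g + F h.
Proof.
(* The 4 collects an error [2 * d] for the sum and [d] for each summand. *)
move=> Cg Ch; apply: (@eq_of_close _ _ (M * 4)) => d d0.
have [s gs] := approx_ex Cg d0; have [t ht] := approx_ex Ch d0.
have ght : approx (g \+ h) (s ++ t) (d + d).
  split=> [|xi]; first exact: addr_gt0.
  rewrite kernel_comb_cat /= opprD addrACA (le_trans (ler_normD _ _))//.
  by rewrite lerD ?gs.2 ?ht.2.
have := F_close (C0D Cg Ch) ght; have := F_close Cg gs; have := F_close Ch ht.
rewrite lincomb_cat !ler_norml => /andP[? ?] /andP[? ?] /andP[? ?].
by apply/andP; split; lra.
Qed.

Let FZ c g : C0 g -> F (fun x => c * g x) = c * F g.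
Proof.
(* The added 1 keeps the accuracy required by [approx] positive when [c = 0]. *)
move=> Cg; apply: (@eq_of_close _ _ (M * (`|c| + 1) + M * `|c|)) => d d0.
have [s gs] := approx_ex Cg d0.
have cgs : approx (fun x => c * g x) (scale_comb c s) ((`|c| + 1) * d).
  split=> [|xi]; first by rewrite mulr_gt0// ltr_wpDl.
  rewrite kernel_comb_scale -mulrBr normrM.
  apply: (@le_trans _ _ (`|c| * d)); first by rewrite ler_wpM2l// gs.2.
  by rewrite ler_wpM2r ?(ltW d0)// lerDl.
have := F_close (C0Z c Cg) cgs; have := F_close Cg gs.
move=> /(ler_wpM2l (normr_ge0 c)); rewrite -normrM mulrBr lincomb_scale => H1 H2.
rewrite (_ : _ - _ = (F (fun x => c * g x) - c * lincomb f s) -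
  (c * F g - c * lincomb f s)); last ring.
rewrite (le_trans (ler_normB _ _))// (le_trans (lerD H2 H1))//.
by rewrite le_eqVlt; apply/orP; left; apply/eqP; ring.
Qed.

Let F_bound c g : C0 g -> (forall x, `|g x| <= c) -> `|F g| <= M * c.
Proof.
move=> Cg gc; apply/ler_addgt0Pr => e e0.
have c0 : 0 <= c by exact: le_trans (normr_ge0 _) (gc point).
have M10 : 0 < 2 * (M + 1) by have := M_ge0; lra.
pose d := e / (2 * (M + 1)); have d0 : 0 < d by rewrite divr_gt0.
have Md : M * d * 2 <= e.
  rewrite /d mulrA -[leLHS]mulrAC ler_pdivrMr//.
  by have := mulr_ge0 M_ge0 (ltW e0); have := e0; nra.
have [s gs] := approx_ex Cg d0.
have cd0 : 0 < c + d by rewrite ltr_wpDl.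
have : `|lincomb f s| <= M * (c + d).
  apply: lincomb_bound => // xi.
  rewrite (_ : kernel_comb s xi = g xi - (g xi - kernel_comb s xi)); last ring.
  by rewrite (le_trans (ler_normB _ _))// lerD ?gs.2.
have := F_close Cg gs; have := M_ge0; rewrite !ler_norml mulrDr.
by move=> ? /andP[? ?] /andP[? ?]; apply/andP; split; lra.
Qed.

Let F_kappa x : F (kappa x) = f x.
Proof.
apply: (@eq_of_close _ _ M) => d d0.
have xs : approx (kappa x) [:: (1, x)] d.
  split=> // xi; rewrite /kernel_comb /lincomb big_seq1 /= mul1r subrr normr0.
  exact: ltW.
by have := F_close (kernel_kappa.1 x) xs; rewrite /lincomb big_seq1 /= mul1r.
Qed.

Hypotheses (scXi : @second_countable Xi) (lcXi : locally_compact [set: Xi])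
  (hausXi : hausdorff_space Xi).

(** The extension [F] maps [kappa x] to [f x], so a charge that represents [F] is a preimage of
    [f]. *)
Lemma dual_norm_fin_irkbs : irkbs kappa f.
Proof.
have [nu [rnu nuE]] := signed_riesz scXi lcXi hausXi FD FZ F_bound.
exists nu => //; apply/funext => x; rewrite /T_ nuE ?F_kappa//.
exact: kernel_kappa.1.
Qed.

End extension.

(** Exchanging the sums evaluates [kernel_comb s] at the nodes of the net, where it is at most 1 in
    absolute value. *)
Lemma dual_norm_net (theta : seq (R * Xi)) :
  (dual_norm (net kappa theta) <= (net_cost theta)%:E)%E.
Proof.
apply: ge_ereal_sup => _ [s s1 <-]; rewrite lee_fin.
rewrite (_ : lincomb _ s = \sum_(q <- theta) q.1 * kernel_comb s q.2).
  apply: ler_sum => q _; apply: le_trans (ler_norm _) _.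
  by rewrite normrM ler_piMr.
rewrite /lincomb /net; under eq_bigr do rewrite mulr_sumr.
rewrite exchange_big /=; apply: eq_bigr => q _.
rewrite /kernel_comb /lincomb mulr_sumr; apply: eq_bigr => p _.
by rewrite mulrCA.
Qed.

End dual_norm.

(** * Weak* continuity of evaluations and semicontinuity of the dual norm *)

Section wstar_topology.
Context {R : realType} {X : metricType R} (e : X).

Lemma wstar_functional_continuous m :
  continuous (wstar_functional e m : wstar_Lip e -> R).
Proof.
move=> f A nA.
have /cvg_sup/(_ m) fm : nbhs (f : wstar_Lip e) --> (f : wstar_Lip e).
  exact: cvg_id.
exact: (fm _ (@initial_continuous _ _ (wstar_functional e m) f A nA)).
Qed.

Lemma const_ae_cauchy (s : seq (R * X * X)) : (ae_cauchy (fun=> mol s)).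
Proof.
split=> [n|eps e0]; first by exists s.
exists 0%N => i j _ _; rewrite (_ : _ \- _ = fun=> 0) ?ae_norm0//.
by apply/funext => z /=; rewrite subrr.
Qed.

Lemma lipB_cst (f : Lip X) (c : R) : lipschitz_fun (fun x => f x - c).
Proof.
have [k kf] := LipP f; exists k => x y.
by rewrite (_ : _ - _ = f x - f y)//; ring.
Qed.

Definition Lip_of (f : X -> R) (lf : lipschitz_fun f) : Lip X :=
  exist (fun f => f \in @lipschitz_fun R X) f (mem_set lf).

(** [f x] is [f e] plus the pairing of [f - f e] with the molecule [delta_x - delta_e], embedded as
    a constant Cauchy sequence. *)
Lemma wstar_eval_continuous x :
  continuous (fun f : wstar_Lip e => (f : Lip X) x).
Proof.
pose u : cauchy_mol := exist
    (fun u => u \in @ae_cauchy R X) _ (mem_set (const_ae_cauchy [:: (1, x, e)])).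
pose m : AE X := (\pi_(AE X) u)%qT.
have E (f : Lip X) : f x = wstar_functional e None f + wstar_functional e (Some m) f.
  rewrite /= (ae_pairingE u (Lip_of (lipB_cst f (f e)))).
  have -> : (fun n => mol_pairing (u n) (Lip_of (lipB_cst f (f e)))) =
      cst (f x - f e).
    apply/funext => n; rewrite /u /cauchy_fun /= mol_pairingE big_seq1 /=.
    rewrite mul1r; change (f x - f e - (f e - f e) = f x - f e); ring.
  by rewrite lim_cst//; ring.
rewrite (_ : (fun f : wstar_Lip e => (f : Lip X) x) =
  (fun f : wstar_Lip e => wstar_functional e None f + wstar_functional e (Some m) f)); last first.
  by apply/funext => f; exact: E.
move=> f; exact: (cvgD (@wstar_functional_continuous None f)
  (@wstar_functional_continuous (Some m) f)).
Qed.

Lemma wstar_lincomb_continuous s :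
  continuous (fun f : wstar_Lip e => lincomb (f : Lip X) s).
Proof.
elim: s => [|p s IH].
  rewrite (_ : (fun _ => _) = cst 0); first exact: cst_continuous.
  by apply/funext => f; rewrite lincomb_nil.
rewrite (_ : (fun _ => _) = fun f : wstar_Lip e =>
  p.1 * (f : Lip X) p.2 + lincomb (f : Lip X) s); last first.
  by apply/funext => f; rewrite /lincomb big_cons.
move=> f; exact: (cvgD (cvgM (cvg_cst p.1) (@wstar_eval_continuous p.2 f)) (IH f)).
Qed.

Context {Xi : ptopologicalType} (kappa : X -> Xi -> R).

Lemma dual_norm_lsc_minorant :
  lsc_minorant e (net kappa) net_cost (dual_norm kappa : Lip X -> \bar R).
Proof.
split=> [alpha|f]; last first.
  by apply: le_ereal_inf_tmp => _ [theta /= <- <-]; exact: dual_norm_net.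
rewrite (_ : [set f | _] = \bigcap_(s in [set s | forall xi, `|kernel_comb kappa s xi| <= 1])
    [set f : wstar_Lip e | lincomb (f : Lip X) s <= alpha]).
  apply: closed_bigI => s _.
  apply: (@preimage_closed _ _ (fun f : wstar_Lip e => lincomb (f : Lip X) s)
    [set y | y <= alpha]) => [f _|]; last exact: closed_le.
  exact: wstar_lincomb_continuous.
apply/seteqP; split=> [f /= fa s s1|f fa] /=.
  by rewrite -lee_fin; apply: le_trans fa; exact: lincomb_le_dual_norm.
by apply: ge_ereal_sup => _ [s s1 <-]; rewrite lee_fin; exact: fa.
Qed.

End wstar_topology.

(** * Integration of C_0 functions against charges *)

Section charge_integral_theory.
Context {R : realType} {Xi : ptopologicalType}.
Implicit Types (nu : {charge set (borel Xi) -> \bar R}) (g h : Xi -> R).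

Lemma charge_integralD nu g h : C0 g -> C0 h ->
  charge_integral nu (g \+ h) = charge_integral nu g + charge_integral nu h.
Proof.
move=> Cg Ch; have [p [q [D [pE qE _ _ _]]]] := jordan_of_charge nu.
rewrite /charge_integral pE qE.
by rewrite !RintegralD//; first ring; exact: C0_integrable.
Qed.

Lemma charge_integralZ nu c g : C0 g ->
  charge_integral nu (fun xi => c * g xi) = c * charge_integral nu g.
Proof.
move=> Cg; have [p [q [D [pE qE _ _ _]]]] := jordan_of_charge nu.
rewrite /charge_integral pE qE.
by rewrite !RintegralZl//; first ring; exact: C0_integrable.
Qed.

Lemma tv_norm_fin nu : exists2 a, 0 <= a & tv_norm nu = a%:E.
Proof.
have [p [q [D [pE qE _ _ _]]]] := jordan_of_charge nu.
exists (fine (p setT) + fine (q setT)); first by rewrite addr_ge0// fine_ge0.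
rewrite EFinD !fineK ?fin_num_measure//.
by change (jpos nu setT + jneg nu setT = p setT + q setT)%E; rewrite pE qE.
Qed.

Lemma charge_integral_le nu g c : C0 g -> (forall xi, `|g xi| <= c) ->
  `|charge_integral nu g| <= c * fine (tv_norm nu).
Proof.
move=> Cg gc; have [p [q [D [pE qE _ _ _]]]] := jordan_of_charge nu.
have -> : fine (tv_norm nu) = fine (p setT) + fine (q setT).
  rewrite -fineD ?fin_num_measure//.
  change (fine (jpos nu setT + jneg nu setT) = fine (p setT + q setT)).
  by rewrite pE qE.
have le (mu : {finite_measure set (borel Xi) -> \bar R}) :
    `|\int[mu]_x g x| <= c * fine (mu setT).
  have gi : mu.-integrable setT (EFin \o (g : borel Xi -> R)) by exact: C0_integrable.
  rewrite (le_trans (le_normr_Rintegral _ gi))// -Rintegral_cst//.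
  apply: le_Rintegral => //.
  - exact: integrable_norm gi.
  - apply: (@bounded_integrable _ _ mu (cst c) `|c|) => //.
by rewrite /charge_integral pE qE (le_trans (ler_normB _ _))// mulrDr lerD.
Qed.

(** Pointwise, [g] is at least 1 minus twice the indicator of the complement of [K]. *)
Lemma Rintegral_ge_except (mu : {finite_measure set (borel Xi) -> \bar R}) g
    (K : set (borel Xi)) : measurable K -> C0 g ->
  (forall xi, - 1 <= g xi) -> (forall xi, K xi -> g xi = 1) ->
  fine (mu setT) - 2 * fine (mu (~` K)) <= \int[mu]_x g x.
Proof.
move=> mK Cg g1 gK; have mCK := measurableC mK.
have ii c (A : set (borel Xi)) : measurable A ->
    mu.-integrable setT (EFin \o (fun x => c * \1_A x)).
  move=> mA; apply: (@bounded_integrable _ _ mu _ `|c|) => //.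
    by apply: measurable_funM => //; exact: measurable_indic.
  by move=> x; rewrite normrM indicE ler_piMr// normr_nat; case: (_ \in _).
rewrite -[fine _]mul1r -mulNr -!Rintegral_indicZ// -RintegralD//; [|exact: ii|exact: ii].
apply: le_Rintegral => //; last 2 first.
- exact: C0_integrable.
- move=> x _; rewrite !indicE in_setT mulr1.
  have [/gK ->|nK] := pselect (K x).
    by case: (_ \in _); rewrite ?mulr1 ?mulr0; lra.
  by rewrite mem_set//= mulr1; have := g1 x; lra.
exact: (integrableD measurableT (ii 1 _ measurableT) (ii (- 2) _ mCK)).
Qed.

End charge_integral_theory.

(** * The total variation is bounded by the dual norm *)

Section dual_norm_of_radon.
Context {R : realType} {X : metricType R} {Xi : ptopologicalType}.
Variable kappa : X -> Xi -> R.
Hypothesis kernel_kappa : irkbs_kernel kappa.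
Implicit Types (nu : {charge set (borel Xi) -> \bar R}).

Lemma C0_kernel_comb s : C0 (kernel_comb kappa s).
Proof.
by apply: C0_sum => p; apply: C0Z; exact: kernel_kappa.1.
Qed.

Lemma lincomb_T nu s :
  lincomb (T_ kappa nu) s = charge_integral nu (kernel_comb kappa s).
Proof.
elim: s => [|p s IH].
  rewrite lincomb_nil.
  rewrite (_ : kernel_comb _ _ = fun xi => 0 * kernel_comb kappa [::] xi).
    by rewrite charge_integralZ ?mul0r//; exact: C0_kernel_comb.
  by apply/funext => xi; rewrite /kernel_comb lincomb_nil mul0r.
rewrite (_ : kernel_comb _ _ =
    (fun xi => p.1 * kappa p.2 xi) \+ kernel_comb kappa s); last first.
  by apply/funext => xi; rewrite /kernel_comb /lincomb big_cons.
rewrite charge_integralD; [|apply: C0Z; exact: kernel_kappa.1|exact: C0_kernel_comb].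
rewrite charge_integralZ; last exact: kernel_kappa.1.
by rewrite -IH /lincomb big_cons.
Qed.

Hypotheses (scXi : @second_countable Xi) (lcXi : locally_compact [set: Xi])
  (hausXi : hausdorff_space Xi).

(** [g] imitates the sign of [nu]: it is 1 on a compact [K1] inside the positive set [D] and -1 on a
    compact [K2] inside its complement. Each Jordan part loses at most [2 * e]. *)
Lemma C0_sign_approx nu (e : R) : radon nu -> 0 < e ->
  exists g : Xi -> R, [/\ C0 g, forall xi, `|g xi| <= 1 &
    fine (tv_norm nu) - 4 * e <= charge_integral nu g].
Proof.
move=> rnu e0; have [p [q [D [pE qE mD pD qD]]]] := jordan_of_charge nu.
have [K1 [U1 [cK1 oU1 K1D DU1 UK1]]] := rnu _ _ mD e0.
have [K2 [U2 [cK2 oU2 K2D DU2 UK2]]] := rnu _ _ (measurableC mD) e0.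
have clK1 := compact_closed hausXi cK1; have clK2 := compact_closed hausXi cK2.
have mK1 := closed_borel clK1; have mK2 := closed_borel clK2.
have [g1 [Cg1 g101 g1K g1U]] := @compact_open_C0_separation R Xi scXi lcXi hausXi
  K1 (~` K2) cK1 (closed_openC clK2) (fun x K1x K2x => K2D _ K2x (K1D _ K1x)).
have [g2 [Cg2 g201 g2K g2U]] := @compact_open_C0_separation R Xi scXi lcXi hausXi
  K2 (~` K1) cK2 (closed_openC clK1) (fun x K2x K1x => K2D _ K2x (K1D _ K1x)).
have leE (mu : {finite_measure set (borel Xi) -> \bar R}) (A B : set (borel Xi)) :
    measurable A -> measurable B -> A `<=` B -> (mu A <= mu B)%E.
  by move=> mA mB AB; apply: le_measure => //; apply: mem_set.
have absE (A : set Xi) : abs_charge nu A = (p A + q A)%E.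
  by change (jpos nu A + jneg nu A = p A + q A)%E; rewrite pE qE.
have mU1 := open_borel oU1; have mU2 := open_borel oU2.
have mDK1 : measurable (D `\` K1) by exact: measurableD.
have mDK2 : measurable (~` D `\` K2 : set (borel Xi)).
  by apply: measurableD => //; exact: measurableC.
(* [p] is carried by [D], so only [D] minus [K1] counts, which lies in the small set [U1] minus
   [K1]. *)
have pK1 : (p (~` K1) < e%:E)%E.
  rewrite (_ : p (~` K1) = p (D `\` K1)); last first.
    rewrite pD ?pD//; last exact: measurableC.
    by congr (nu _); apply/seteqP; split=> x [] //= [].
  apply: le_lt_trans UK1; rewrite absE.
  apply: (@le_trans _ _ (p (U1 `\` K1))); last by rewrite leeDl.
  by apply: leE => // [|x [/DU1]]//; exact: measurableD.
have qK2 : (q (~` K2) < e%:E)%E.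
  rewrite (_ : q (~` K2) = q (~` D `\` K2)); last first.
    rewrite qD ?qD//; last exact: measurableC.
    by congr (- nu _)%E; apply/seteqP; split=> x [] //= [].
  apply: le_lt_trans UK2; rewrite absE.
  apply: (@le_trans _ _ (q (U2 `\` K2))); last by rewrite leeDr.
  by apply: leE => // [|x [/DU2]]//; exact: measurableD.
have Cg := C0B Cg1 Cg2; have Cg' := C0B Cg2 Cg1.
exists (g1 \- g2); split=> // [xi|].
  by rewrite ler_norml /=; have := g101 xi; have := g201 xi; lra.
rewrite /charge_integral pE qE.
have fin (mu : {finite_measure set (borel Xi) -> \bar R}) (A : set (borel Xi)) :
    measurable A -> (mu A < e%:E)%E -> fine (mu A) < e.
  by move=> mA; rewrite -lte_fin fineK// fin_num_measure.
have {}pK1 := fin _ _ (measurableC mK1) pK1.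
have {}qK2 := fin _ _ (measurableC mK2) qK2.
have pg := @Rintegral_ge_except R Xi p (g1 \- g2) K1 mK1 Cg.
have qg := @Rintegral_ge_except R Xi q (g2 \- g1) K2 mK2 Cg'.
have : fine (p setT) - 2 * fine (p (~` K1)) <= \int[p]_x (g1 \- g2) x.
  apply: pg => xi; first by have := g101 xi; have := g201 xi; rewrite /=; lra.
  by move=> K1x; rewrite /= g1K// g2U ?subr0// => -/(_ K1x).
have : fine (q setT) - 2 * fine (q (~` K2)) <= \int[q]_x (g2 \- g1) x.
  apply: qg => xi; first by have := g101 xi; have := g201 xi; rewrite /=; lra.
  by move=> K2x; rewrite /= g2K// g1U ?subr0// => -/(_ K2x).
have -> : \int[q]_x (g2 \- g1) x = - \int[q]_x (g1 \- g2) x.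
  rewrite -mulN1r -RintegralZl//; last exact: C0_integrable.
  by apply: eq_Rintegral => x _ /=; ring.
rewrite /tv_norm absE fineD ?fin_num_measure//.
move: (\int[q]_x _) (\int[p]_x _) (fine (p setT)) (fine (q setT)) pK1 qK2.
move: (fine (p _)) (fine (q _)) => *; lra.
Qed.

Lemma tv_norm_le_dual_norm nu : radon nu ->
  (tv_norm nu <= dual_norm kappa (T_ kappa nu))%E.
Proof.
move=> rnu; have [a a0 aE] := tv_norm_fin nu; rewrite aE.
have := @dual_norm_ge0 R X Xi kappa (T_ kappa nu).
case ME : (dual_norm kappa (T_ kappa nu)) => [M| |]; [|by move=> _; exact: leey|by rewrite leeNy_eq].
rewrite !lee_fin => M0; apply/ler_addgt0Pr => eps eps0.
(* Below, [a - 4 * e <= e * a + M * (1 + e)]: the error of [g], that of its approximation by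
   [kernel_comb s], and the bound [1 + e] on the latter. Hence [a <= M + e * (M + a + 4)]. *)
have c0 : 0 < M + a + 4 by lra.
pose e := eps / (M + a + 4); have e0 : 0 < e by rewrite divr_gt0.
have eE : e * (M + a + 4) = eps by rewrite /e divfK// gt_eqF.
have [g [Cg g1]] := C0_sign_approx rnu e0; rewrite aE /= => gi.
have [_ [s _ <-] gs] := kernel_kappa.2 g Cg e e0.
have {}gs xi : `|g xi - kernel_comb kappa s xi| <= e.
  rewrite -lee_fin; apply: le_trans (ltW gs).
  by apply: ereal_sup_ubound; exists xi.
have := @lincomb_bound _ _ _ kappa _ _ (1 + e) s ME (addr_gt0 ltr01 e0).
rewrite lincomb_T => sM.
have : `|charge_integral nu (kernel_comb kappa s)| <= M * (1 + e).
  apply: sM => xi.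
  rewrite (_ : _ xi = g xi - (g xi - kernel_comb kappa s xi)); last ring.
  by rewrite (le_trans (ler_normB _ _))// lerD.
have Cgs := C0B Cg (C0_kernel_comb s).
have := @charge_integral_le _ _ nu _ _ Cgs gs; rewrite aE /=.
have gE : charge_integral nu g = charge_integral nu (g \- kernel_comb kappa s) +
    charge_integral nu (kernel_comb kappa s).
  rewrite -charge_integralD//; last exact: C0_kernel_comb.
  by congr charge_integral; apply/funext => xi /=; rewrite subrK.
move: gi; rewrite gE !ler_norml => gi /andP[_ ?] /andP[_ ?].
nra.
Qed.

End dual_norm_of_radon.

(** * Approximation by nets *)

Section discretization.
Context {R : realType} {X : metricType R} {Xi : ptopologicalType}.
Variable kappa : X -> Xi -> R.
Hypothesis C0_kappa : forall x, C0 (kappa x).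
Implicit Types (mu : {finite_measure set (borel Xi) -> \bar R}) (xs : seq X)
  (theta : seq (R * Xi)) (A B : set (borel Xi)).

(** The error is relative to the mass of [A], so that errors over disjoint pieces add up to the
    right bound however many pieces there are. *)
Definition quadrature mu (eps : R) xs A theta :=
  [/\ forall p, p \in theta -> 0 <= p.1 /\ A p.2,
      \sum_(p <- theta) p.1 = fine (mu A) &
      forall x, x \in xs ->
        `|net kappa theta x - \int[mu]_(xi in A) kappa x xi| <= eps * fine (mu A)].

Lemma net_cat theta1 theta2 x :
  net kappa (theta1 ++ theta2) x = net kappa theta1 x + net kappa theta2 x.
Proof. by rewrite /net big_cat. Qed.

Lemma quadratureU mu eps xs A B theta1 theta2 : measurable A -> measurable B ->
  [disjoint A & B] -> quadrature mu eps xs A theta1 ->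
  quadrature mu eps xs B theta2 ->
  quadrature mu eps xs (A `|` B) (theta1 ++ theta2).
Proof.
move=> mA mB AB [A1 A2 A3] [B1 B2 B3].
have muAB : fine (mu (A `|` B)) = fine (mu A) + fine (mu B).
  rewrite measureU//; first by rewrite fineD// fin_num_measure.
  exact/disj_set2P.
split=> [p|| x xs_x].
- rewrite mem_cat => /orP[/A1[? ?]|/B1[? ?]]; split=> //; first by left.
  by right.
- by rewrite big_cat/= A2 B2 muAB.
have mAB := measurableU _ _ mA mB.
rewrite net_cat Rintegral_setU//; last exact: C0_integrable.
rewrite opprD addrACA (le_trans (ler_normD _ _))// muAB mulrDr.
by rewrite lerD ?A3 ?B3.
Qed.

Lemma quadrature_empty mu eps xs A : A = set0 -> quadrature mu eps xs A [::].
Proof.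
move=> ->; split=> [//||x _]; first by rewrite big_nil measure0.
by rewrite /net big_nil Rintegral_set0 subrr normr0 measure0 mulr0.
Qed.

(** Induction on [xs]. With no test point, one point mass suffices. For a new point [x], [A] is cut
    along the levels of [kappa x] into slices of height [eps], and the quadratures for [xs] on the
    slices are concatenated. *)
Lemma quadrature_ex mu (eps : R) xs A : 0 < eps -> measurable A ->
  exists theta, quadrature mu eps xs A theta.
Proof.
move=> eps0; elim: xs A => [|x xs IH] A mA.
  have [[xi Axi]|noA] := pselect (exists xi, A xi); last first.
    exists [::]; apply: quadrature_empty; apply/seteqP; split=> // xi Axi.
    by apply: noA; exists xi.
  exists [:: (fine (mu A), xi)]; split=> //; last by rewrite big_seq1.
  by move=> p; rewrite inE => /eqP -> /=; split=> //; exact: fine_ge0.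
have [c c0 kc] := C0_bounded (C0_kappa x).
have mk := continuous_borel (C0_kappa x).1.
(* Induction on the number [n] of slices: the lowest one is handled by the hypothesis on [xs], the
   rest by that on [n]. The strict upper bound makes [A] empty for [n = 0]. *)
suff slice n : forall (l : R) A, measurable A ->
    (forall xi, A xi -> l <= kappa x xi < l + n%:R * eps) ->
    exists theta, quadrature mu eps (x :: xs) A theta.
  apply: (slice (Num.truncn ((c + c) / eps)).+1 (- c) A mA) => xi _.
  have := kc xi; rewrite ler_norml => /andP[-> /le_lt_trans]; apply.
  by rewrite -ltrBlDl opprK -ltr_pdivrMr// truncnS_gt.
elim: n => [|n IHn] l {}A {}mA Al.
  exists [::]; apply: quadrature_empty; apply/seteqP; split=> // xi /Al.
  by rewrite mul0r addr0 => /andP[/le_lt_trans /[apply]]; rewrite ltxx.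
pose H : set (borel Xi) := [set xi | l + eps <= kappa x xi].
have mH : measurable H.
  apply: closed_borel.
  apply: (@preimage_closed _ _ (kappa x) [set y | l + eps <= y]) => [xi _|].
    exact: (C0_kappa x).1.
  exact: closed_ge.
have mAH : measurable (A `&` H) by exact: measurableI.
have mADH : measurable (A `\` H) by exact: measurableD.
have [theta1 [pos1 sum1 int1]] := IH _ mADH.
have [|theta2 quad2] := IHn (l + eps) _ mAH.
  move=> xi [Axi Hxi]; have /andP[_] := Al xi Axi.
  by rewrite -natr1 mulrDl mul1r addrA (addrAC l) => ->; rewrite andbT.
have slice_eps xi : (A `\` H) xi -> l <= kappa x xi <= l + eps.
  move=> [/Al/andP[-> _] /negP]; rewrite -ltNge /= => ?; exact: ltW.
exists (theta1 ++ theta2); rewrite -(setDUK (@subIsetl _ A H)).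
rewrite setUC (_ : A `\` (A `&` H) = A `\` H); last first.
  by apply/seteqP; split=> xi [Axi nH]; split=> //; [move=> Hxi; apply: nH|move=> []].
apply: quadratureU => //.
  by apply/disj_set2P; apply/seteqP; split=> // xi [[_ nH] [_ /nH]].
split=> // y; rewrite inE => /predU1P[->|]; last exact: int1.
(* For the new point, the net and the integral both lie between [l * m] and [(l + eps) * m], since
   all nodes are in the slice and the masses agree. *)
have muA1 := sum1; set m := fine (mu _) in muA1 *.
have lm : l * m <= net kappa theta1 x <= (l + eps) * m.
  rewrite -muA1 !mulr_sumr /net; apply/andP; split; rewrite big_seq [leRHS]big_seq;
    apply: ler_sum => p /pos1[p0 /slice_eps/andP[? ?]]; nra.
have lI : l * m <= \int[mu]_(xi in A `\` H) kappa x xi <= (l + eps) * m.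
  have ik := C0_integrable mu mADH (C0_kappa x).
  have ic (b : R) : mu.-integrable (A `\` H) (EFin \o cst b).
    by apply: (@bounded_integrable _ _ mu (cst b) `|b|).
  rewrite -!Rintegral_cst//; apply/andP; split.
    by apply: le_Rintegral => //; [exact: ic|move=> xi /slice_eps/andP[]].
  by apply: le_Rintegral => //; [exact: ic|move=> xi /slice_eps/andP[]].
move: lm lI => /andP[? ?] /andP[? ?]; rewrite ler_norml; apply/andP; split; lra.
Qed.

(** Quadratures of the two Jordan parts, the second with negated weights: the cost is at most the
    sum of the two masses. *)
Lemma net_approx (nu : {charge set (borel Xi) -> \bar R}) (eps : R) xs : 0 < eps ->
  exists theta, ((net_cost theta)%:E <= tv_norm nu)%E /\
    forall x, x \in xs -> `|net kappa theta x - T_ kappa nu x| <= eps.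
Proof.
move=> eps0; have [p [q [D [pE qE _ _ _]]]] := jordan_of_charge nu.
have tvE : tv_norm nu = (fine (p setT) + fine (q setT))%:E.
  rewrite EFinD !fineK ?fin_num_measure//.
  by change (jpos nu setT + jneg nu setT = p setT + q setT)%E; rewrite pE qE.
set a := fine (p setT) in tvE; set b := fine (q setT) in tvE.
have a0 : 0 <= a by exact: fine_ge0.
have b0 : 0 <= b by exact: fine_ge0.
have c0 : 0 < a + b + 1 by lra.
have e0 : 0 < eps / (a + b + 1) by rewrite divr_gt0.
have [t1 [pos1 sum1 int1]] := @quadrature_ex p _ xs setT e0 measurableT.
have [t2 [pos2 sum2 int2]] := @quadrature_ex q _ xs setT e0 measurableT.
pose t2' := [seq (- w.1, w.2) | w <- t2].
have t2'E x : net kappa t2' x = - net kappa t2 x.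
  rewrite /net big_map -sumrN; by apply: eq_bigr => w _; rewrite mulNr.
exists (t1 ++ t2'); split=> [|x xs_x].
  rewrite tvE lee_fin /net_cost big_cat /= big_map /=.
  rewrite -/a -/b in sum1 sum2; rewrite -sum1 -sum2.
  by rewrite lerD// big_seq [leRHS]big_seq; apply: ler_sum => w;
    [move=> /pos1|move=> /pos2]; move=> [w0 _]; rewrite ?normrN ger0_norm.
rewrite net_cat t2'E /T_ /charge_integral pE qE.
have := int1 x xs_x; have := int2 x xs_x; rewrite -/a -/b.
rewrite !ler_norml => /andP[? ?] /andP[? ?].
have abE : eps / (a + b + 1) * (a + b) <= eps.
  by rewrite mulrAC ler_pdivrMr//; nra.
by apply/andP; split; lra.
Qed.

End discretization.

(** * Weak* closeness from pointwise closeness under a Lipschitz bound *)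

Section wstar_bounded.
Context {R : realType} {X : metricType R} (e : X).

(** A late term of a representing Cauchy sequence serves for all [g] at once; the bound passes to
    the limit. *)
Lemma ae_pairing_approx (m : AE X) (d : R) : 0 < d ->
  exists s, forall (k : R) (g : X -> R), klip k g ->
    `|ae_pairing m g - mol_pairing (mol s) g| <= `|k| * d.
Proof.
move=> d0; have [mu cu] := cauchy_molP (repr m).
have [N cN] := cu _ d0; have [s _ sE] := mu N.
exists s => k g kg; rewrite sE.
pose gL := Lip_of (ex_intro _ k kg : lipschitz_fun g).
have cv := @mol_pairing_cvg R X (repr m) gL.
have cvN : `|mol_pairing ((repr m : cauchy_mol) n) g -
    mol_pairing ((repr m : cauchy_mol) N) g| @[n --> \oo] -->
    `|ae_pairing m g - mol_pairing ((repr m : cauchy_mol) N) g|.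
  by apply: cvg_norm; apply: cvgB; [exact: cv|exact: cvg_cst].
rewrite -(cvg_lim _ cvN)//.
apply: limr_le; first by apply/cvg_ex; eexists; exact: cvN.
exists N => // n /= Nn; rewrite -mol_pairingB//.
rewrite (le_trans (mol_pairing_le kg (moleculeB (mu n) (mu N))))//.
by rewrite ler_wpM2l// ltW// cN.
Qed.

(** For functions with Lipschitz constant [K], the pairing is uniformly close to that with one
    molecule, which sees only the finitely many points [xs]. *)
Lemma wstar_functional_close (m : option (AE X)) (f : Lip X) (K eps : R) : 0 < eps ->
  exists (xs : seq X) (d : R), 0 < d /\ forall g : Lip X, klip K g ->
    (forall x, x \in xs -> `|g x - f x| < d) ->
    `|wstar_functional e m g - wstar_functional e m f| < eps.
Proof.
move=> eps0; case: m => [m|]; last first.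
  by exists [:: e], eps; split=> // g _; apply; rewrite inE.
have [k kf] := LipP f.
(* Half of [eps] pays for replacing [m] by the molecule, for [g] and for [f]; the other half pays
   for the values at the points of the molecule, of total weight [w]. *)
pose c := `|K| + `|k| + 1; have c0 : 0 < c by rewrite ltr_wpDl// addr_ge0.
have d0 : 0 < eps / (2 * c) by rewrite divr_gt0// mulr_gt0.
have [s sm] := ae_pairing_approx m d0.
pose w := \sum_(p <- s) `|p.1.1|; have w0 : 0 <= w by exact: sumr_ge0.
have w40 : 0 < 4 * (w + 1) by lra.
exists ([seq p.1.2 | p <- s] ++ [seq p.2 | p <- s]), (eps / (4 * (w + 1))).
split=> [|g Kg close]; first by rewrite divr_gt0.
have lipB (h : X -> R) (r : R) : klip r h -> klip r (fun x => h x - h e).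
  by move=> rh x y; rewrite opprB addrA subrK.
have := sm _ _ (lipB _ _ Kg); have := sm _ _ (lipB _ _ kf).
rewrite !mol_pairingE /=.
set F := ae_pairing m _; set Sf := \sum_(p <- s) _.
set G := ae_pairing m _; set Sg := \sum_(p <- s) _ => H1 H2.
have H3 : `|Sg - Sf| <= w * (2 * (eps / (4 * (w + 1)))).
  rewrite /Sg /Sf -sumrB (le_trans (ler_norm_sum _ _ _))// /w mulr_suml.
  rewrite big_seq [leRHS]big_seq; apply: ler_sum => p ps.
  rewrite -mulrBr normrM ler_wpM2l//.
  have -> : g p.1.2 - g e - (g p.2 - g e) - (f p.1.2 - f e - (f p.2 - f e)) =
      (g p.1.2 - f p.1.2) - (g p.2 - f p.2) by ring.
  rewrite (le_trans (ler_normB _ _))// mulr2n mulrDl mul1r lerD// ltW// close//.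
    by rewrite mem_cat; apply/orP; left; apply/mapP; exists p.
  by rewrite mem_cat; apply/orP; right; apply/mapP; exists p.
have H4 : w * (2 * (eps / (4 * (w + 1)))) < eps / 2.
  by rewrite mulrA mulrA ltr_pdivrMr//; nra.
have H5 : `|K| * (eps / (2 * c)) + `|k| * (eps / (2 * c)) <= eps / 2.
  rewrite -mulrDl mulrA ler_pdivrMr ?mulr_gt0// /c.
  by have := normr_ge0 K; have := normr_ge0 k; nra.
rewrite (_ : G - F = (G - Sg) + (Sg - Sf) - (F - Sf)); last ring.
rewrite (le_lt_trans (ler_normB _ _))//.
have := ler_normD (G - Sg) (Sg - Sf); lra.
Qed.

End wstar_bounded.

(** * The extended cost is bounded by the total variation *)

Section upper_bound.
Context {R : realType} {X : metricType R} (e : X) {Xi : ptopologicalType}.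
Variables (kappa : X -> Xi -> R) (L : R).
Hypothesis C0_kappa : forall x, C0 (kappa x).
Hypothesis lip_kappa : lipschitz_kernel L kappa.
Implicit Types (nu : {charge set (borel Xi) -> \bar R}).

Lemma klip_net theta (a : R) : net_cost theta <= a ->
  klip (a * `|L|) (net kappa theta).
Proof.
move=> ta x y; rewrite /net -sumrB (le_trans (ler_norm_sum _ _ _))//.
apply: (@le_trans _ _ (net_cost theta * (`|L| * mdist x y))); last first.
  by rewrite -mulrA ler_wpM2r// mulr_ge0// mdist_ge0.
rewrite /net_cost mulr_suml; apply: ler_sum => p _.
rewrite -mulrBr normrM ler_wpM2l//.
apply: (@le_trans _ _ (L * mdist x y)); last first.
  by rewrite ler_wpM2r ?mdist_ge0// ler_norm.
rewrite -lee_fin; apply: le_trans (lip_kappa x y).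
by apply: ereal_sup_ubound; exists p.2.
Qed.

Lemma lipschitz_net theta : lipschitz_fun (net kappa theta).
Proof. by exists (net_cost theta * `|L|); exact: klip_net. Qed.

(** For each pair of points there are nets close to [T_ kappa nu] at both, with the common Lipschitz
    constant of [klip_net]. *)
Lemma lipschitz_T nu : lipschitz_fun (T_ kappa nu).
Proof.
have [a a0 aE] := tv_norm_fin nu; exists (a * `|L|) => x y.
apply/ler_addgt0Pr => eps eps0; have e20 : 0 < eps / 2 by rewrite divr_gt0.
have [theta [+ close]] := net_approx C0_kappa nu [:: x; y] e20.
rewrite aE lee_fin => /klip_net/(_ x y).
have := close x; have := close y; rewrite !inE !eqxx orbT => /(_ isT) Hy /(_ isT) Hx.
rewrite (_ : T_ kappa nu x - T_ kappa nu y = (net kappa theta x - net kappa theta y) -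
  (net kappa theta x - T_ kappa nu x) + (net kappa theta y - T_ kappa nu y)); last ring.
move: Hx Hy; set u := net kappa theta x - _; set v := net kappa theta y - _.
move=> Hx Hy H; rewrite (le_trans (ler_normD _ _))//.
have := ler_normB (net kappa theta x - net kappa theta y) u; lra.
Qed.

(** Nets of cost at most [a], close to [f] on finite sets of points, generate a proper filter
    converging to [f] in w*. An lsc minorant is at most [a] on them, hence at [f]. *)
Lemma ext_rep_cost_le_tv (f : Lip X) nu : T_ kappa nu = f ->
  (ext_rep_cost e (net kappa) net_cost f <= tv_norm nu)%E.
Proof.
move=> Tf; have [a a0 aE] := tv_norm_fin nu; rewrite aE.
apply: ge_ereal_sup => _ [G [lscG GC] <-].
pose bX (i : seq X * R) : set (wstar_Lip e) := [set g | exists2 theta,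
  (net_cost theta <= a) /\ net kappa theta = (g : Lip X) &
  forall x, x \in i.1 -> `|(g : Lip X) x - f x| < i.2].
pose F := filter_from [set i : seq X * R | 0 < i.2] bX.
have FF : ProperFilter F.
  apply: filter_from_proper; first apply: filter_from_filter.
  - by exists ([::], 1) => /=.
  - move=> [xs d] [ys d'] /= d0 d'0; exists (xs ++ ys, Num.min d d').
      by rewrite /= lt_min d0.
    move=> g [theta tg close]; split; exists theta => // x xx.
      have := close x; rewrite /= mem_cat xx => /(_ isT).
      by rewrite lt_min => /andP[].
    have := close x; rewrite /= mem_cat xx orbT => /(_ isT).
    by rewrite lt_min => /andP[].
  - move=> [xs d] /= d0; have d20 : 0 < d / 2 by rewrite divr_gt0.
    have [theta [+ close]] := net_approx C0_kappa nu xs d20.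
    rewrite aE lee_fin => ta.
    exists (Lip_of (lipschitz_net theta)).
    exists theta => // x /close; rewrite Tf => /le_lt_trans; apply.
    by rewrite ltr_pdivrMr// ltr_pMr// ltr1n.
(* The bound on the cost gives all members the Lipschitz constant of [klip_net], as
   [wstar_functional_close] requires. *)
have Ff : F --> (f : wstar_Lip e).
  apply/cvg_sup => m A; rewrite /= (@nbhsE (initial_topology (wstar_functional e m))) => -[_ [[V oV <-] Vf] VA].
  apply: filterS VA _.
  have /nbhs_ballP[eps /= eps0 epsV] : nbhs (wstar_functional e m f) V.
    exact: open_nbhs_nbhs.
  have [xs [d [d0 close]]] := @wstar_functional_close R X e m f (a * `|L|) eps eps0.
  exists (xs, d) => //= g [theta [ta tg] gf]; apply: epsV.
  rewrite /ball /= distrC; apply: close => //.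
  by have := klip_net ta; rewrite tg.
have SG : F [set g | (G g <= a%:E)%E].
  exists ([::], 1) => //= g [theta [ta tg] _]; apply: le_trans (GC g) _.
  apply: (@le_trans _ _ (net_cost theta)%:E); last by rewrite lee_fin.
  by apply: ereal_inf_lbound; exists theta.
have clG : closed ([set g | (G g <= a%:E)%E] : set (wstar_Lip e)) := lscG a.
apply: (@closed_cvg (wstar_Lip e) (wstar_Lip e) F FF id _ clG SG f).
exact: Ff.
Qed.

End upper_bound.

Theorem theorem7p10 (R : realType) (X : metricType R) (e : X)
  (Xi : ptopologicalType) (kappa : X -> Xi -> R) (L : R)
  (sepX : separable X)
  (scXi : @second_countable Xi)
  (lcXi : locally_compact [set: Xi])
  (hausXi : hausdorff_space Xi)
  (irkbs_kappa : irkbs_kernel kappa)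
  (lip_kappa : lipschitz_kernel L kappa) :
  (forall f : Lip X,
    (forall Uf : irkbs kappa f,
      ext_rep_cost e (net kappa) net_cost f = irkbs_norm Uf) /\
    (~ irkbs kappa f ->
      ext_rep_cost e (net kappa) net_cost f = +oo%E)) /\
  native_space e (net kappa) net_cost = irkbs kappa.
Proof.
have C0_kappa := irkbs_kappa.1.
have le_tv := @ext_rep_cost_le_tv R X e Xi kappa L C0_kappa lip_kappa.
have ge_dual f := ext_rep_cost_largest (dual_norm_lsc_minorant e kappa) f.
have eq_tv (f : Lip X) nu : radon nu -> T_ kappa nu = f ->
    ext_rep_cost e (net kappa) net_cost f = tv_norm nu.
  move=> rnu Tf; apply/eqP; rewrite eq_le le_tv//=.
  apply: le_trans (ge_dual f); rewrite -Tf.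
  exact: (tv_norm_le_dual_norm irkbs_kappa scXi lcXi hausXi rnu).
have infinite (f : Lip X) : ~ irkbs kappa f ->
    ext_rep_cost e (net kappa) net_cost f = +oo%E.
  move=> nf; apply/eqP; rewrite -leye_eq; apply: le_trans (ge_dual f).
  have := dual_norm_ge0 kappa f; case fE : (dual_norm kappa f) => [M| |]//.
  by case: nf; exact: dual_norm_fin_irkbs fE scXi lcXi hausXi.
split=> [f|].
  split=> [Uf|]; last exact: infinite.
  (* [eq_tv] holds for every Radon preimage, in particular for the chosen one. *)
  rewrite /irkbs_norm; case: (cid2 Uf) => nu rnu Tnu; exact: eq_tv.
apply/seteqP; split=> [_ [f /= fin <-]|_ [nu rnu <-]].
  by apply: contrapT => /infinite fy; move: fin; rewrite fy ltxx.
exists (Lip_of (lipschitz_T C0_kappa lip_kappa nu)) => //=.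
rewrite (eq_tv _ _ rnu)//; have [a _ ->] := tv_norm_fin nu; exact: ltry.
Qed.
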